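(* Fix $n\ge1$. Suppose we are given an arbitrary collection $p_{\star|\mathrm{GS}}$ of real numbers $$p^{[k],j_1,\ldots,j_r}_{\varkappa,\iota_1,\ldots,\iota_r}\qquad(r\ge0,\ k,j_1,\ldots,j_r\in\{1,\ldots,n\},\ \varkappa,\iota_1,\ldots,\iota_r\in\{0,1\}^n)$$ (in the special case: without the index $\varkappa$), given only for those index sequences such that $$\forall s\qquad j_s\neq\min\{h:\iota_s(h)=1\}$$ (no restriction on $j_s$ when $\iota_s=(0,\ldots,0)$). Then it can be extended uniquely to a collection $p_\star$ of real numbers with arbitrary indices such that the expansion $\Psi(Q+R)_k=\sum_{r\ge0}E^{\langle r\rangle}_k$ with $$E^{\langle r\rangle}_k=\sum_{\iota_1,\ldots,\iota_r,\varkappa,\ j_1,\ldots,j_r}p^{[k],j_1,\ldots,j_r}_{\varkappa,\iota_1,\ldots,\iota_r}\,(R/Q)^{\iota_1}_{j_1}\cdots(R/Q)^{\iota_r}_{j_r}\,Q^\varkappa Q_k \tag{1}$$ (in the special case: $$E^{\langle r\rangle}_k=\Bigl(\sum_{\iota_1,\ldots,\iota_r,\ j_1,\ldots,j_r}p^{[k],j_1,\ldots,j_r}_{\iota_1,\ldots,\iota_r}\,(R/Q)^{\iota_1}_{j_1}\cdots(R/Q)^{\iota_r}_{j_r}\Bigr)Q_k\,) \tag{2}$$ yields a formal FQ operation $\Psi$ (in the special case: satisfying (vL)). The recipe for $\Psi(A)$ is as follows: let $Q=\mathcal O^{\mathrm{GS}}(A)$, $A=Q+R$, and apply the expansion (1)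 (in the special case: (2)) with the coefficients $p_{\star|\mathrm{GS}}$ only. This leaves $((n-1)2^n+1)^r2^nn$ (in the special case: $((n-1)2^n+1)^rn$) real coefficients on the $r$th expansion level to be chosen freely.
   Context: Convenient algebra: a unital real algebra $\mathfrak A$ with a decreasing filtration $\mathfrak A=\mathfrak A^{(0)}\supset\mathfrak A^{(1)}\supset\cdots$, $\mathfrak A^{(i)}\mathfrak A^{(j)}\subset\mathfrak A^{(i+j)}$, complete and Hausdorff for the filtration, with all $\mathfrak A/\mathfrak A^{(i)}$ finite-dimensional. Homomorphisms are unital and filtration-preserving. Clifford system: $(Q_1,\ldots,Q_n)$ with $Q_iQ_j+Q_jQ_i=-2\delta_{ij}1$. For $Q^2=\pm1$: $R^0_Q=\frac12(R+Q^{-1}RQ)$, $R^1_Q=\frac12(R-Q^{-1}RQ)$; superscripts/subscripts are iterated. For a Clifford system $Q$, $R\in\mathfrak A^n$, $\iota\in\{0,1\}^n$: $(R/Q)^\iota_j=(R_jQ_j^{-1}){}^{\iota_1}_{Q_1}\cdots{}^{\iota_n}_{Q_n}$. Multipower: $Q^\iota=Q_1^{\iota_1}\cdots Q_n^{\iota_n}$. A formal FQ operation $\Psi$ assigns to certain $n$-tuples from convenient algebras $\mathfrak A$ another $n$-tuple from $\mathfrak A$, such that: (Frm) $A$ is in the domain of $\Psi$ iff there is a Clifford system $Q$ with $A-Q\in(\mathfrak A^{(1)})^n$. (Nat) If $\Psi(A)=B$ and $\phi$ is a homomorphism, then $\Psi(\phi(A))=\phi(B)$ (componentwise), and the domain on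 $\mathfrak A\oplus\mathfrak B$ contains the product of the domains. (Formal analyticity) If $Q$ is a Clifford system and $R\in(\mathfrak A^{(1)})^n$, then $\Psi(Q+R)_k=\sum_{r\ge0}E_k^{\langle r\rangle}$ with $E_k^{\langle r\rangle}=\sum\psi^{[k],j_1,\ldots,j_r}_{\iota_0,\ldots,\iota_r}Q^{\iota_0}R_{j_1}Q^{\iota_1}\cdots R_{j_r}Q^{\iota_r}$, with fixed real coefficients $\psi$ independent of $Q$ (sum over $\iota_s\in\{0,1\}^n$, $j_s\in\{1,\ldots,n\}$). Equivalently, after decomposing $R_j=\sum_\iota(R/Q)^\iota_jQ_j$, $E_k^{\langle r\rangle}$ has the form (1) with fixed real coefficients. (vL): if $\Psi(A_1,\ldots,A_n)=(B_1,\ldots,B_n)$ then $\Psi((-1)^{\iota_1}A_1,\ldots,(-1)^{\iota_n}A_n)=((-1)^{\iota_1}B_1,\ldots,(-1)^{\iota_n}B_n)$. $\mathcal O^{\mathrm{GS}}(A_1,\ldots,A_n)=(Q_1,\ldots,Q_n)$ with $Q_1=\mathrm{pol}\,A_1$, $Q_k=\mathrm{pol}((A_k){}^1_{Q_1}\cdots{}^1_{Q_{k-1}})$, where $\mathrm{pol}\,H=\int_0^{2\pi}\frac{H}{\cos^2t-H^2\sin^2t}\frac{dt}{2\pi}$. *)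

(* Defs.v *)
From HB Require Import structures.
From mathcomp Require Import all_boot all_order all_algebra.
From mathcomp Require Import all_classical all_reals all_analysis.

Set Implicit Arguments.
Unset Strict Implicit.
Unset Printing Implicit Defensive.

Import Order.TTheory GRing.Theory Num.Theory.
Import numFieldNormedType.Exports.

Local Open Scope classical_set_scope.
Local Open Scope ring_scope.

Record convenient (R : realType) (A : algType R) (F : nat -> set A) : Prop := {
  conv_0 : F 0%N = setT;
  conv_decr : forall i, F i.+1 `<=` F i;
  conv_zero : forall i, F i 0;
  conv_lin : forall i (a : R) x y, F i x -> F i y -> F i (a *: x + y);
  conv_mul : forall i j x y, F i x -> F j y -> F (i + j)%N (x * y);
  conv_hausdorff : forall x, (forall i, F i x) -> x = 0;
  (* The filtration topology is first countable, so Cauchy sequences suffice. *)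
  conv_complete : forall u : nat -> A,
    (forall i, exists N, forall m n, (N <= m)%N -> (N <= n)%N ->
       F i (u m - u n)) ->
    exists l, forall i, exists N, forall m, (N <= m)%N -> F i (l - u m);
  (* A / F i is spanned by the classes of finitely many elements of A. *)
  conv_findim : forall i, exists (d : nat) (b : 'I_d -> A), forall x,
    exists c : 'I_d -> R, F i (x - \sum_(l < d) c l *: b l)
}.

Record convAlg (R : realType) := ConvAlg {
  conv_car :> algType R;
  filt : nat -> set conv_car;
  convP : convenient filt
}.

Definition filt_hom (R : realType) (A B : convAlg R)
    (phi : {lrmorphism A -> B}) : Prop :=
  forall i x, filt (c := A) i x -> filt (c := B) i (phi x).

Definition prod_filt (R : realType) (A B : convAlg R) (i : nat) :
    set (A * B)%type :=
  [set z | filt (c := A) i z.1 /\ filt (c := B) i z.2].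

Lemma prod_convenient (R : realType) (A B : convAlg R) :
  convenient (A := (A * B)%type : algType R) (@prod_filt R A B).
Proof.
have sumE (d : nat) (c : 'I_d -> R) (b : 'I_d -> (A * B)%type) :
    \sum_(l < d) c l *: b l =
    (\sum_(l < d) c l *: (b l).1, \sum_(l < d) c l *: (b l).2).
  elim/big_rec3: _ => // i x y _ _ ->; exact: erefl.
have cA := convP A; have cB := convP B; split.
- by apply/seteqP; split => // z _; rewrite /prod_filt /= (conv_0 cA) (conv_0 cB).
- by move=> i z [z1 z2]; split; [exact: (conv_decr cA)|exact: (conv_decr cB)].
- by move=> i; split; [exact: (conv_zero cA)|exact: (conv_zero cB)].
- by move=> i a x y [x1 x2] [y1 y2]; split;
    [exact: (conv_lin cA)|exact: (conv_lin cB)].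
- by move=> i j x y [x1 x2] [y1 y2]; split;
    [exact: (conv_mul cA)|exact: (conv_mul cB)].
- move=> [x y] h; congr pair.
    by apply: (conv_hausdorff cA) => i; case: (h i).
  by apply: (conv_hausdorff cB) => i; case: (h i).
- move=> u hu.
  have [l1 h1] : exists l, forall i, exists N, forall m, (N <= m)%N ->
      filt (c := A) i (l - (u m).1).
    apply: (conv_complete cA) => i; have [N hN] := hu i; exists N => m n lem len.
    by have [] := hN m n lem len.
  have [l2 h2] : exists l, forall i, exists N, forall m, (N <= m)%N ->
      filt (c := B) i (l - (u m).2).
    apply: (conv_complete cB) => i; have [N hN] := hu i; exists N => m n lem len.
    by have [] := hN m n lem len.
  exists (l1, l2) => i; have [N1 k1] := h1 i; have [N2 k2] := h2 i.
  exists (maxn N1 N2) => m; rewrite geq_max => /andP[le1 le2].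
  by split; [exact: k1|exact: k2].
- move=> i; have [d1 [b1 h1]] := conv_findim cA i.
  have [d2 [b2 h2]] := conv_findim cB i.
  exists (d1 + d2)%N, (fun l : 'I_(d1 + d2) => match fintype.split l with
    | inl l1 => (b1 l1, 0) | inr l2 => (0, b2 l2) end : A * B) => -[x y].
  have [c1 k1] := h1 x; have [c2 k2] := h2 y.
  exists (fun l : 'I_(d1 + d2) =>
    match fintype.split l with inl l1 => c1 l1 | inr l2 => c2 l2 end).
  have El l : fintype.split (lshift d2 l) = inl l :> 'I_d1 + 'I_d2.
    exact: (unsplitK (inl l)).
  have Er l : fintype.split (rshift d1 l) = inr l :> 'I_d1 + 'I_d2.
    exact: (unsplitK (inr l)).
  rewrite sumE !big_split_ord /=; split => /=.
    under eq_bigr do rewrite El /=.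
    under [X in _ - (_ + X)]eq_bigr do rewrite Er /= scaler0.
    by rewrite big1_eq addr0.
  under eq_bigr do rewrite El /= scaler0.
  under [X in _ - (_ + X)]eq_bigr do rewrite Er /=.
  by rewrite big1_eq add0r.
Qed.

Definition prodConv (R : realType) (A B : convAlg R) : convAlg R :=
  ConvAlg (prod_convenient A B).

Definition filt_sum (R : realType) (A : convAlg R) (u : nat -> A) (S : A) :
    Prop :=
  forall i, exists N, forall m, (N <= m)%N ->
    filt i (S - \sum_(r < m) u r).

(* Total by convention: 0 on the elements that are not invertible. *)
Definition ainv (R : realType) (A : convAlg R) (x : A) : A :=
  xget 0 [set y | x * y = 1 /\ y * x = 1].

Definition clifford (R : realType) (n : nat) (A : convAlg R) (Q : 'I_n -> A) :
    Prop :=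
  forall i j, Q i * Q j + Q j * Q i = (- 2 *+ (i == j))%:A.

Definition near_clifford (R : realType) (n : nat) (A : convAlg R)
    (X Q : 'I_n -> A) : Prop :=
  clifford Q /\ forall k, filt 1 (X k - Q k).

(* [csplit false Q X] and [csplit true Q X] are X^0_Q and X^1_Q. *)
Definition csplit (R : realType) (A : convAlg R) (e : bool) (Q X : A) : A :=
  2^-1 *: (X + (-1) ^+ e * (ainv Q * X * Q)).

Definition multi (n : nat) := {ffun 'I_n -> bool}.

Definition mpow (R : realType) (n : nat) (A : convAlg R) (Q : 'I_n -> A)
    (i : multi n) : A :=
  \prod_(h < n) Q h ^+ i h.

(* (X/Q)^i_j *)
Definition ratio (R : realType) (n : nat) (A : convAlg R) (Q X : 'I_n -> A)
    (i : multi n) (j : 'I_n) : A :=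
  foldl (fun Y h => csplit (i h) (Q h) Y) (X j * ainv (Q j)) (enum 'I_n).

(* [is_pol H P] says that P is the integral defining pol H.  The integral is
   taken in every finite-dimensional quotient A / filt i, coordinatewise: the
   linear forms on A / filt i are those on A that vanish on filt i. *)
Definition pol_den (R : realType) (A : convAlg R) (H : A) (t : R) : A :=
  (cos t ^+ 2)%:A - sin t ^+ 2 *: H ^+ 2.

Definition is_pol (R : realType) (A : convAlg R) (H P : A) : Prop :=
  (forall t, exists y, pol_den H t * y = 1 /\ y * pol_den H t = 1) /\
  forall i (f : {scalar A}), (forall x, filt i x -> f x = 0) ->
    let g (t : R) : R := f (H * ainv (pol_den H t)) in
    lebesgue_measure.-integrable `[0, 2 * pi] (EFin \o g) /\
    f P = (2 * pi)^-1 * \int[lebesgue_measure]_(t in `[0, 2 * pi]) g t.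

(* Q = O^GS(X) *)
Definition is_OGS (R : realType) (n : nat) (A : convAlg R) (X Q : 'I_n -> A) :
    Prop :=
  forall k : 'I_n,
    is_pol (foldl (fun Y h => csplit true (Q h) Y) (X k)
                  [seq h : 'I_n <- enum 'I_n | (h < k)%N])
           (Q k).

Definition letter (n : nat) := ('I_n * multi n)%type.

(* A word of length r lists the pairs (j_s, iota_s). *)
Definition word (n r : nat) := r.-tuple (letter n).

Definition an_coef (R : realType) (n : nat) :=
  'I_n -> forall r : nat, multi n -> word n r -> R.

(* The index iota_0 is separate: the pair (j_s, iota_s) stands for
   X_{j_s} Q^{iota_s}. *)
Definition an_term (R : realType) (n : nat) (psi : an_coef R n)
    (A : convAlg R) (Q X : 'I_n -> A) (k : 'I_n) (r : nat) : A :=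
  \sum_(i0 : multi n) \sum_(w : word n r)
    psi k r i0 w *: (mpow Q i0 * \prod_(l <- w) (X l.1 * mpow Q l.2)).

Definition fq_coef (R : realType) (n : nat) :=
  'I_n -> forall r : nat, multi n -> word n r -> R.

Definition fq_coef0 (R : realType) (n : nat) :=
  'I_n -> forall r : nat, word n r -> R.

Definition ratio_word (R : realType) (n r : nat) (A : convAlg R)
    (Q X : 'I_n -> A) (w : word n r) : A :=
  \prod_(l <- w) ratio Q X l.2 l.1.

Definition exp_term (R : realType) (n : nat) (p : fq_coef R n)
    (A : convAlg R) (Q X : 'I_n -> A) (k : 'I_n) (r : nat) : A :=
  \sum_(kappa : multi n) \sum_(w : word n r)
    p k r kappa w *: (ratio_word Q X w * mpow Q kappa * Q k).

Definition exp_term0 (R : realType) (n : nat) (p : fq_coef0 R n)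
    (A : convAlg R) (Q X : 'I_n -> A) (k : 'I_n) (r : nat) : A :=
  (\sum_(w : word n r) p k r w *: ratio_word Q X w) * Q k.

Definition is_min_supp (n : nat) (j : 'I_n) (i : multi n) : bool :=
  i j && [forall h : 'I_n, i h ==> (j <= h)%N].

(* [gs_letter (j, iota)] is the condition j <> min {h | iota(h) = 1} with no
   restriction when that set is empty. *)
Definition gs_letter (n : nat) (l : letter n) : bool :=
  ~~ is_min_supp l.1 l.2.

Definition gs_word (n r : nat) := {w : word n r | all (@gs_letter n) w}.

Definition gs_coef (R : realType) (n : nat) :=
  'I_n -> forall r : nat, multi n -> gs_word n r -> R.

Definition gs_coef0 (R : realType) (n : nat) :=
  'I_n -> forall r : nat, gs_word n r -> R.

Definition gs_term (R : realType) (n : nat) (p : gs_coef R n)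
    (A : convAlg R) (Q X : 'I_n -> A) (k : 'I_n) (r : nat) : A :=
  \sum_(kappa : multi n) \sum_(w : gs_word n r)
    p k r kappa w *: (ratio_word Q X (val w) * mpow Q kappa * Q k).

Definition gs_term0 (R : realType) (n : nat) (p : gs_coef0 R n)
    (A : convAlg R) (Q X : 'I_n -> A) (k : 'I_n) (r : nat) : A :=
  (\sum_(w : gs_word n r) p k r w *: ratio_word Q X (val w)) * Q k.

Definition extends (R : realType) (n : nat) (pGS : gs_coef R n)
    (p : fq_coef R n) : Prop :=
  forall k r kappa (w : gs_word n r), p k r kappa (val w) = pGS k r kappa w.

Definition extends0 (R : realType) (n : nat) (pGS : gs_coef0 R n)
    (p : fq_coef0 R n) : Prop :=
  forall k r (w : gs_word n r), p k r (val w) = pGS k r w.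

(* A partial operation is given by its graph: [Psi A X Y] means Psi(X) = Y. *)
Definition operation (R : realType) (n : nat) :=
  forall A : convAlg R, ('I_n -> A) -> ('I_n -> A) -> Prop.

Definition in_dom (R : realType) (n : nat) (Psi : operation R n)
    (A : convAlg R) (X : 'I_n -> A) : Prop :=
  exists Y, Psi A X Y.

(* [expands Psi E]: Psi(Q + X)_k = \sum_r E Q X k r for every Clifford system Q
   and every X with entries in the first filtration step. *)
Definition expands (R : realType) (n : nat) (Psi : operation R n)
    (E : forall A : convAlg R, ('I_n -> A) -> ('I_n -> A) -> 'I_n -> nat -> A) :
    Prop :=
  forall (A : convAlg R) (Q X : 'I_n -> A), clifford Q ->
    (forall j, filt 1 (X j)) ->
    exists2 Y, Psi A (fun j => Q j + X j) Y &
      forall k, filt_sum (E A Q X k) (Y k).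

Record formalFQ (R : realType) (n : nat) (Psi : operation R n) : Prop := {
  fq_fun : forall (A : convAlg R) (X Y Z : 'I_n -> A),
    Psi A X Y -> Psi A X Z -> Y = Z;
  fq_frm : forall (A : convAlg R) (X : 'I_n -> A),
    in_dom Psi X <-> exists Q : 'I_n -> A, near_clifford X Q;
  fq_nat : forall (A B : convAlg R) (phi : {lrmorphism A -> B}),
    filt_hom phi -> forall X Y : 'I_n -> A,
    Psi A X Y -> Psi B (phi \o X) (phi \o Y);
  fq_prod : forall (A B : convAlg R) (X : 'I_n -> A) (Y : 'I_n -> B),
    in_dom Psi X -> in_dom Psi Y ->
    in_dom Psi (A := prodConv A B) (fun j => (X j, Y j));
  fq_analytic : exists psi : an_coef R n, expands Psi (an_term psi)
}.

Definition vL (R : realType) (n : nat) (Psi : operation R n) : Prop :=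
  forall (A : convAlg R) (X Y : 'I_n -> A), Psi A X Y ->
  forall i : multi n,
    Psi A (fun j => (-1) ^+ i j * X j) (fun j => (-1) ^+ i j * Y j).

Definition gs_recipe (R : realType) (n : nat) (Psi : operation R n)
    (E : forall A : convAlg R, ('I_n -> A) -> ('I_n -> A) -> 'I_n -> nat -> A) :
    Prop :=
  forall (A : convAlg R) (X Y : 'I_n -> A), Psi A X Y ->
    (exists Q : 'I_n -> A, is_OGS X Q) /\
    forall Q : 'I_n -> A, is_OGS X Q ->
      near_clifford X Q /\
      forall k, filt_sum (E A Q (fun j => X j - Q j) k) (Y k).

(* Main.v *)
Require Import Defs.
From HB Require Import structures.
From mathcomp Require Import all_boot all_order all_algebra.
From mathcomp Require Import all_classical all_reals all_analysis.
From mathcomp Require Import ring zify.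

(** Write [A = Q + X] with [Q] a Clifford system and [X] in the first step of the
    filtration. There are many such decompositions, but exactly one of them is
    produced by Gram-Schmidt orthogonalization, and for it the components
    [(X/Q)^i_j] with [j = min {h | i h}] vanish ([ratio_OGS]). Hence an FQ
    operation is determined by its coefficients on the remaining words: to
    evaluate it, expand around [O^GS(A)] ([expands_recipe]). Conversely, for given
    coefficients on these words this recipe is taken as a definition ([gs_op]),
    and the point is that it then has an expansion of the same form around every
    Clifford system near [A].

    Orthogonalization rests on pol. With [N = - H^2 - 1], the denominator in its
    definition is [1 + sin^2 t N], so that pol [H] equals [H] times the series
    [sum (-1)^m c_m N^m], where [c_m] is the mean of [sin^(2m)]. The Cauchy square
    of the sequence [c] is constantly 1 ([sin_mean_square]), so this is
    [H (- H^2)^(-1/2)], a square root of -1 with the same commutation relations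
    as [H] ([is_pol_near], [ps_comm]). By induction the iterated residues give a Clifford
    system ([is_OGS_exists], [is_OGS_near]); as pol is unique, because linear forms
    separate the points of the finite-dimensional quotients ([filt_separation]),
    it is the only one ([is_OGS_uniq]).

    For the existence of the expansion, no composition of power series is carried
    out. Constructions that are uniform in the algebra, in [Q] and in [X], and
    that are, modulo each step of the filtration, universal combinations of the
    monomials [(X/Q)^{i_1}_{j_1} ... (X/Q)^{i_r}_{j_r} Q^k], are closed under the
    algebra operations: letters and generators commute up to signs which do not
    depend on the algebra. They contain [Q] and [X], hence [O^GS(Q + X)]
    ([fq_span_ogs]) and the value of the recipe ([fq_span_gs_value]). The
    combinations obtained modulo the various steps fit together because the
    monomials are linearly independent in a concrete algebra, the truncated free
    model in which letters act by concatenation on words and generators act by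
    signed toggling of exponents ([model_independent]); this gives one
    expansion ([fq_series_exists]). The same model proves uniqueness of the
    extension ([extension_uniq]). Restricted to the Gram-Schmidt letters, the
    Clifford system of the model is its own orthogonalization ([model_OGS]), so
    the coefficients found there are the prescribed ones ([gs_op_expands]).

    In the special case the recipe is compatible with sign changes of the
    variables ([gs_op_vL]), and conversely this compatibility forces the
    coefficients of nontrivial multipowers to vanish ([vL_multipower]). The
    special case is thus the general one applied to coefficients extended by zero.
    For the counting, every nonzero multi-index excludes exactly one letter, which
    leaves [n 2^n - (2^n - 1)] letters ([card_gs_letter]). *)

Set Implicit Arguments.
Unset Strict Implicit.
Unset Printing Implicit Defensive.

Import Order.TTheory GRing.Theory Num.Theory.
Import numFieldNormedType.Exports.

Local Open Scope ring_scope.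

(* The name otherwise refers to the representatives of fractions. *)
Local Notation ratio := Defs.ratio.

(** * Filtrations, convergence and power series *)

Section FiltrationCalculus.
Variables (R : realType) (A : convAlg R).
Implicit Types (x y z : A) (i j m : nat) (u : nat -> A).

Lemma filt0 i : filt i (0 : A).
Proof. exact: (conv_zero (convP A)). Qed.

Lemma filtT x : filt 0 x.
Proof. by rewrite (conv_0 (convP A)). Qed.

Lemma filtZ i (a : R) x : filt i x -> filt i (a *: x).
Proof.
by move=> h; rewrite -[_ *: _]addr0; apply: (conv_lin (convP A)) => //; exact: filt0.
Qed.

Lemma filtD i x y : filt i x -> filt i y -> filt i (x + y).
Proof. by move=> hx hy; rewrite -[x]scale1r; exact: (conv_lin (convP A)). Qed.

Lemma filtN i x : filt i x -> filt i (- x).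
Proof. by move=> h; rewrite -scaleN1r; exact: filtZ. Qed.

Lemma filtBC i x y : filt i (x - y) -> filt i (y - x).
Proof. by move=> h; rewrite -opprB; exact: filtN. Qed.

Lemma filtM i j x y : filt i x -> filt j y -> filt (i + j) (x * y).
Proof. exact: (conv_mul (convP A)). Qed.

Lemma filtMl i x y : filt i y -> filt i (x * y).
Proof. by move=> h; rewrite -[i]add0n; apply: filtM => //; exact: filtT. Qed.

Lemma filtMr i x y : filt i x -> filt i (x * y).
Proof. by move=> h; rewrite -[i]addn0; apply: filtM => //; exact: filtT. Qed.

Lemma filt_le i j x : (i <= j)%N -> filt j x -> filt i x.
Proof.
elim: j => [|j IH]; first by rewrite leqn0 => /eqP ->.
rewrite leq_eqVlt => /orP[/eqP -> //|]; rewrite ltnS => le h.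
by apply: IH => //; exact: (conv_decr (convP A)).
Qed.

Lemma filt_bigsum i (I : Type) (s : seq I) (P : pred I) (f : I -> A) :
  (forall l, P l -> filt i (f l)) -> filt i (\sum_(l <- s | P l) f l).
Proof.
move=> h; elim/big_rec: _ => [|l x Pl hx]; first exact: filt0.
by apply: filtD => //; exact: h.
Qed.

Lemma filtX i x : filt 1 x -> filt i (x ^+ i).
Proof.
move=> h; elim: i => [|i IH]; first exact: filtT.
by rewrite exprS -add1n; exact: filtM.
Qed.

Lemma filt_eq0 x : (forall i, filt i x) -> x = 0.
Proof. exact: (conv_hausdorff (convP A)). Qed.

Lemma filt_eq x y : (forall i, filt i (x - y)) -> x = y.
Proof. by move=> h; apply/eqP; rewrite -subr_eq0; apply/eqP/filt_eq0. Qed.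

Lemma eqm_trans i y x z : filt i (x - y) -> filt i (y - z) -> filt i (x - z).
Proof. by move=> h1 h2; rewrite -(subrK y x) -addrA; exact: filtD. Qed.

Lemma eqmD i x x' y y' :
  filt i (x - x') -> filt i (y - y') -> filt i (x + y - (x' + y')).
Proof. by move=> h1 h2; rewrite opprD addrACA; exact: filtD. Qed.

Lemma eqmN i x x' : filt i (x - x') -> filt i (- x - - x').
Proof. by move=> h; rewrite -opprD; exact: filtN. Qed.

Lemma eqmM i x x' y y' :
  filt i (x - x') -> filt i (y - y') -> filt i (x * y - x' * y').
Proof.
move=> h1 h2; apply: (@eqm_trans _ (x' * y)).
  by rewrite -mulrBl; exact: filtMr.
by rewrite -mulrBr; exact: filtMl.
Qed.

Lemma eqmZ i (a : R) x x' : filt i (x - x') -> filt i (a *: x - a *: x').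
Proof. by move=> h; rewrite -scalerBr; exact: filtZ. Qed.

Lemma eqm_refl i x : filt i (x - x).
Proof. by rewrite subrr; exact: filt0. Qed.

Lemma filt_tail u i m : (forall r, filt r (u r)) -> (i <= m)%N ->
  filt i (\sum_(r < m) u r - \sum_(r < i) u r).
Proof.
move=> hu le; rewrite -(subnKC le) big_split_ord /= addrAC subrr add0r.
by apply: filt_bigsum => r _; apply: filt_le (hu _); exact: leq_addr.
Qed.

(** Completeness in the form used throughout: a series whose term of rank [r]
    lies in step [r] has a sum, with the remainders controlled rank by rank. *)
Lemma filt_series u : (forall r, filt r (u r)) ->
  exists S, forall i, filt i (S - \sum_(r < i) u r).
Proof.
move=> hu; pose s m := \sum_(r < m) u r.
have tail i m : (i <= m)%N -> filt i (s m - s i) by exact: filt_tail.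
have [|S hS] := conv_complete (convP A) (u := s).
  move=> i; exists i => m l hm hl; apply: (@eqm_trans _ (s i)); first exact: tail.
  by apply: filtBC; exact: tail.
exists S => i; have [N hN] := hS i.
apply: (@eqm_trans _ (s (maxn N i))); first by apply: hN; exact: leq_maxl.
by apply: tail; exact: leq_maxr.
Qed.

Lemma filt_sumP u S : (forall i, filt i (S - \sum_(r < i) u r)) -> filt_sum u S.
Proof.
move=> h i; exists i => m le; apply: filt_le le _; exact: h.
Qed.

Lemma filt_sum_remainder u S : (forall r, filt r (u r)) -> filt_sum u S ->
  forall i, filt i (S - \sum_(r < i) u r).
Proof.
move=> hu hS i; have [N hN] := hS i.
apply: (@eqm_trans _ (\sum_(r < maxn N i) u r)).
  by apply: hN; exact: leq_maxl.
by apply: filt_tail => //; exact: leq_maxr.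
Qed.

Lemma filt_sum_uniq u S T : filt_sum u S -> filt_sum u T -> S = T.
Proof.
move=> hS hT; apply: filt_eq => i; have [N hN] := hS i; have [M hM] := hT i.
apply: (@eqm_trans _ (\sum_(r < maxn N M) u r)).
  by apply: hN; exact: leq_maxl.
by apply: filtBC; apply: hM; exact: leq_maxr.
Qed.

Lemma filt_sum_ext u v S : u =1 v -> filt_sum u S -> filt_sum v S.
Proof. by move=> /funext ->. Qed.

Definition is_power_series (c : nat -> R) (N S : A) : Prop :=
  forall i, filt i (S - \sum_(m < i) c m *: N ^+ m).

Lemma ps_exists c N : filt 1 N -> exists S, is_power_series c N S.
Proof.
move=> hN; apply: (@filt_series (fun m => c m *: N ^+ m)) => r.
by apply: filtZ; exact: filtX.
Qed.

Definition conv_prod (c d : nat -> R) (m : nat) : R :=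
  \sum_(j < m.+1) c j * d (m - j)%N.

(** Both factors are truncated to polynomials, and the product of these
   polynomials agrees with the truncated Cauchy product up to a multiple of a
   high power of the variable. *)
Lemma is_power_seriesM c d N S T : filt 1 N -> is_power_series c N S -> is_power_series d N T ->
  is_power_series (conv_prod c d) N (S * T).
Proof.
move=> hN hS hT i; pose tr (e : nat -> R) := \poly_(m < i) e m.
have ev (e : nat -> R) : \sum_(m < i) e m *: N ^+ m = horner_alg N (tr e).
  rewrite /tr poly_def rmorph_sum; apply: eq_bigr => m _ /=.
  by rewrite -mul_polyC rmorphM rmorphXn /= horner_algC horner_algX mulr_algl.
apply: (@eqm_trans _ (horner_alg N (tr c * tr d))).
  by rewrite rmorphM /= -!ev; apply: eqmM; [exact: hS|exact: hT].
rewrite ev -rmorphB /=.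
have -> : tr c * tr d - tr (conv_prod c d) =
    drop_poly i (tr c * tr d) * 'X^i.
  rewrite -{1}(poly_take_drop i (tr c * tr d)) addrAC.
  suff -> : take_poly i (tr c * tr d) = tr (conv_prod c d) by rewrite subrr add0r.
  apply/polyP => m; rewrite coef_take_poly coef_poly; case: ltnP => // lt.
  rewrite coefM; apply: eq_bigr => j _; rewrite !coef_poly.
  have lj : (j < i)%N by apply: leq_ltn_trans lt; rewrite -ltnS.
  by rewrite lj (leq_ltn_trans (leq_subr _ _) lt).
by rewrite rmorphM rmorphXn /= horner_algX; apply: filtMl; exact: filtX.
Qed.

(** A power series in [N] inherits every commutation relation with [N]. *)
Lemma ps_comm c N S Z : is_power_series c N S -> Z * N = N * Z -> Z * S = S * Z.
Proof.
move=> hS hZ; apply: filt_eq => i.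
apply: (@eqm_trans _ (Z * \sum_(m < i) c m *: N ^+ m)).
  by apply: eqmM => //; exact: eqm_refl.
have -> : Z * (\sum_(m < i) c m *: N ^+ m) = (\sum_(m < i) c m *: N ^+ m) * Z.
  rewrite mulr_sumr mulr_suml; apply: eq_bigr => m _.
  by rewrite -scalerAl -scalerAr (commrX m hZ).
by apply: filtBC; apply: eqmM => //; exact: eqm_refl.
Qed.

Lemma geometric_inv N y : filt 1 N -> is_power_series (fun m => (-1) ^+ m) N y ->
  (1 + N) * y = 1 /\ y * (1 + N) = 1.
Proof.
move=> hN hy; have cy := esym (ps_comm hy (erefl (N * N))).
have E : (1 + N) * y = 1.
  apply: filt_eq => i.
  apply: (@eqm_trans _ ((1 + N) * \sum_(m < i) (-1) ^+ m *: N ^+ m)).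
    by apply: eqmM => //; exact: eqm_refl.
  have -> : \sum_(m < i) (-1) ^+ m *: N ^+ m = \sum_(m < i) (- N) ^+ m.
    by apply: eq_bigr => m _; rewrite -[- N]scaleN1r exprZn.
  have -> : 1 + N = - (- N - 1) by rewrite opprB opprK.
  rewrite mulNr -subrX1 opprB addrAC subrr add0r.
  by apply: filtN; rewrite -[- N]scaleN1r exprZn; apply: filtZ; exact: filtX.
split=> //; by rewrite -[RHS]E mulrDl mulrDr mul1r mulr1 cy.
Qed.

Lemma ainvP (x y : A) : x * y = 1 -> y * x = 1 -> ainv x = y.
Proof.
move=> xy yx; apply: xget_unique => // z [xz zx].
by rewrite -[z]mulr1 -xy mulrA zx mul1r.
Qed.

End FiltrationCalculus.

(** * Splitting along square roots of -1 *)

(** Commutation and anticommutation are treated at once: the signs of the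
    factors of a product add up. *)
Definition scomm (R : realType) (A : convAlg R) (b : bool) (Q X : A) : Prop :=
  Q * X = (-1) ^+ b *: (X * Q).

Section Splitting.
Variables (R : realType) (A : convAlg R).
Implicit Types (Q X Y Z : A) (b c e : bool) (i : nat).

Lemma scomm_sym b Q X : scomm b Q X -> scomm b X Q.
Proof. by rewrite /scomm => ->; rewrite scalerA -signr_addb addbb scale1r. Qed.

Lemma scommM b c Q X Y : scomm b Q X -> scomm c Q Y -> scomm (b (+) c) Q (X * Y).
Proof.
rewrite /scomm => hX hY; rewrite mulrA hX -scalerAl -(mulrA X Q) hY.
by rewrite -scalerAr scalerA mulrA signr_addb.
Qed.

Lemma scommD b Q X Y : scomm b Q X -> scomm b Q Y -> scomm b Q (X + Y).
Proof. by rewrite /scomm mulrDr mulrDl scalerDr => -> ->. Qed.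

Lemma scommZ b Q X (a : R) : scomm b Q X -> scomm b Q (a *: X).
Proof. by rewrite /scomm -scalerAr => ->; rewrite -scalerAl !scalerA mulrC. Qed.

Lemma scommN b Q X : scomm b Q X -> scomm b Q (- X).
Proof. by rewrite -scaleN1r; exact: scommZ. Qed.

Lemma scomm_sum b Q (I : Type) (s : seq I) (P : pred I) (f : I -> A) :
  (forall l, P l -> scomm b Q (f l)) -> scomm b Q (\sum_(l <- s | P l) f l).
Proof.
move=> h; elim/big_rec: _ => [|l x Pl hx].
  by rewrite /scomm mulr0 mul0r scaler0.
by apply: scommD => //; exact: h.
Qed.

Lemma scomm1 Q : scomm false Q 1.
Proof. by rewrite /scomm mulr1 mul1r scale1r. Qed.

Lemma scomm_refl Q : scomm false Q Q.
Proof. by rewrite /scomm scale1r. Qed.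

Lemma ainv_sqN1 Q : Q * Q = -1 -> ainv Q = - Q.
Proof. by move=> sq; apply: ainvP; rewrite ?mulrN ?mulNr sq opprK. Qed.

Lemma mulr_sqN1K X Y : Y * Y = -1 -> X * Y * - Y = X.
Proof. by move=> sq; rewrite -mulrA mulrN sq opprK mulr1. Qed.

Lemma mulrN_sqN1K X Y : Y * Y = -1 -> X * - Y * Y = X.
Proof. by move=> sq; rewrite mulrN mulNr -mulrA sq mulrN1 opprK. Qed.

Lemma csplit_sqN1 e Q X : Q * Q = -1 ->
  csplit e Q X = 2^-1 *: (X - (-1) ^+ e *: (Q * X * Q)).
Proof.
move=> sq; rewrite /csplit ainv_sqN1 // !mulNr mulrN; congr (_ *: (_ - _)).
by case: e; rewrite ?expr0 ?expr1 ?mul1r ?scale1r // mulN1r scaleN1r.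
Qed.

Lemma csplitD e Q X Y : csplit e Q (X + Y) = csplit e Q X + csplit e Q Y.
Proof.
by rewrite /csplit -scalerDr; congr (_ *: _); rewrite mulrDr mulrDl mulrDr addrACA.
Qed.

Lemma csplit0 e Q : csplit e Q 0 = 0.
Proof. by rewrite /csplit mulr0 mul0r mulr0 addr0 scaler0. Qed.

Lemma csplitZ e Q (a : R) X : csplit e Q (a *: X) = a *: csplit e Q X.
Proof.
by rewrite /csplit -scalerAr -scalerAl -scalerAr -scalerDr !scalerA mulrC.
Qed.

Lemma half_double X : 2^-1 *: (X + X) = X.
Proof.
by rewrite -[in X + X](scale1r X) -scalerDl scalerA mulVf ?scale1r // pnatr_eq0.
Qed.

Lemma csplit_scomm b e Q X : Q * Q = -1 -> scomm b Q X ->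
  csplit e Q X = if e == b then X else 0.
Proof.
move=> sq h; rewrite csplit_sqN1 // h -scalerAl -mulrA sq mulrN1 !scalerN opprK.
rewrite scalerA -signr_addb; case: e b {h} => [] [] //=;
  by rewrite ?scale1r ?half_double // scaleN1r subrr scaler0.
Qed.

Lemma scomm_csplit e Q X : Q * Q = -1 -> scomm e Q (csplit e Q X).
Proof.
move=> sq; rewrite csplit_sqN1 //; apply: scommZ; rewrite /scomm.
have E1 : Q * (Q * X * Q) = - (X * Q) by rewrite !mulrA sq mulN1r mulNr.
have E2 : Q * X * Q * Q = - (Q * X) by rewrite -(mulrA (Q * X)) sq mulrN1.
rewrite mulrBr mulrBl -scalerAr -scalerAl E1 E2 !scalerN !opprK scalerDr scalerA.
by rewrite -signr_addb addbb scale1r addrC.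
Qed.

Lemma csplit_keep b e Q G X : Q * Q = -1 -> scomm true G Q -> scomm b G X ->
  scomm b G (csplit e Q X).
Proof.
move=> sq hQ hX; rewrite csplit_sqN1 //; apply/scommZ/scommD => //.
apply/scommN/scommZ; rewrite -[b](addbK true) [b (+) true]addbC.
exact: scommM (scommM hQ hX) hQ.
Qed.

Lemma csplitMr b e Q X C : Q * Q = -1 -> scomm b Q C ->
  csplit e Q (X * C) = csplit (e (+) b) Q X * C.
Proof.
move=> sq hC; rewrite !csplit_sqN1 // -scalerAl mulrBl; congr (_ *: (_ - _)).
rewrite -scalerAl signr_addb -scalerA; congr (_ *: _).
have hC' := scomm_sym hC; rewrite /scomm in hC'.
by rewrite -!mulrA hC' -!scalerAr.
Qed.

Lemma eqm_csplit i e Q Q' X X' : Q * Q = -1 -> Q' * Q' = -1 ->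
  filt i (Q - Q') -> filt i (X - X') -> filt i (csplit e Q X - csplit e Q' X').
Proof.
move=> sq sq' hQ hX; rewrite !csplit_sqN1 //; apply: eqmZ.
by apply: eqmD => //; apply/eqmN/eqmZ; do 2!apply: eqmM => //.
Qed.

Lemma csplit_sign (d : bool) e Q X : Q * Q = -1 ->
  csplit e ((-1) ^+ d *: Q) X = csplit e Q X.
Proof.
move=> sq; have S (a : R) : a ^+ 2 = 1 -> (a *: Q) * (a *: Q) = -1.
  by move=> a2; rewrite -scalerAl -scalerAr scalerA -expr2 a2 scale1r.
have sq' := S _ (sqrr_sign R d); rewrite !csplit_sqN1 //.
congr (_ *: (_ - _ *: _)).
by rewrite -!scalerAl -scalerAr scalerA -signr_addb addbb scale1r.
Qed.

End Splitting.

Lemma csplit_hom (R : realType) (A B : convAlg R) (phi : {lrmorphism A -> B}) e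
    (Q X : A) :
  Q * Q = -1 -> phi (csplit e Q X) = csplit e (phi Q) (phi X).
Proof.
move=> sq; have sq' : phi Q * phi Q = -1 by rewrite -rmorphM /= sq rmorphN1.
by rewrite !csplit_sqN1 // linearZ /= linearB /= linearZ /= !rmorphM.
Qed.

Section Clifford.
Variables (R : realType) (n : nat) (A : convAlg R) (Q : 'I_n -> A).

Lemma cliffordP : clifford Q <->
  (forall i, Q i * Q i = -1) /\ (forall i j, i != j -> scomm true (Q i) (Q j)).
Proof.
split=> [h|[sq ac] i j].
  split=> [i|i j ne].
    have := h i i; rewrite eqxx mulr1n => /(congr1 (fun x => 2^-1 *: x)).
    by rewrite half_double scalerA mulrN mulVf ?pnatr_eq0 // scaleN1r.
  have := h i j; rewrite (negbTE ne) mulr0n scale0r => /eqP.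
  by rewrite addr_eq0 => /eqP; rewrite /scomm scaleN1r.
case: eqVneq => [<-|ne].
  by rewrite sq mulr1n scaleNr scaler_nat mulr2n opprD.
by rewrite mulr0n scale0r ac // scaleN1r addNr.
Qed.

Lemma clifford_sq : clifford Q -> forall i, Q i * Q i = -1.
Proof. by case/cliffordP. Qed.

Lemma clifford_anti : clifford Q -> forall i j, i != j -> scomm true (Q i) (Q j).
Proof. by case/cliffordP. Qed.

End Clifford.
(** * The mean values of the even powers of the sine *)

(** The mean value of [sin ^ (2 m)] over a period. *)
Fixpoint sin_mean (R : realType) (m : nat) : R :=
  if m is m'.+1 then (2 * m' + 1)%:R / (2 * m' + 2)%:R * sin_mean R m' else 1.

Arguments sin_mean : simpl never.

Section SinMean.
Variable R : realType.
Local Notation mu := (@lebesgue_measure R).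
Local Notation c := (sin_mean R).
Local Notation period := (`[0, 2 * pi]%classic : set R).

Lemma sin_meanS m : m.+1%:R * (c m.+1 * 2) = (2 * m + 1)%:R * c m.
Proof.
have h : (m.+1%:R : R) != 0 by rewrite pnatr_eq0.
rewrite /sin_mean -/(sin_mean R) (_ : (2 * m + 2)%N = (m.+1 * 2)%N); last by lia.
by rewrite natrM; field; rewrite addrC natr1.
Qed.

(** The generating function G of the means satisfies 2 (1 - x) G' = G, hence
    G^2 solves (1 - x) F' = F, like 1 / (1 - x). In terms of coefficients, a
    symmetrization turns the recurrence of the means into a recurrence of their
    Cauchy square. *)
Lemma sin_mean_square m : conv_prod c c m = 1.
Proof.
elim: m => [|m IH]; first by rewrite /conv_prod big_ord1 mulr1.
have sym k (w : nat -> R) :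
    \sum_(j < k.+1) w j * (c j * c (k - j)%N) * 2 =
    \sum_(j < k.+1) (w j + w (k - j)%N) * (c j * c (k - j)%N).
  rewrite -mulr_suml mulrDr mulr1 -{2}(big_mkord xpredT
    (fun j => w j * (c j * c (k - j)%N))) big_nat_rev /= big_mkord add0n.
  rewrite -big_split /=; apply: eq_bigr => j _.
  rewrite subSS subKn -1?ltnS ?ltn_ord // [c (k - j)%N * c j]mulrC.
  by rewrite mulrDl.
have h : (m.+1%:R : R) != 0 by rewrite pnatr_eq0.
apply: (mulfI h); rewrite mulr1.
rewrite [RHS](_ : _ = m.+1%:R * conv_prod c c m); last by rewrite IH mulr1.
rewrite /conv_prod !mulr_sumr.
transitivity (\sum_(j < m.+2) j%:R * (c j * c (m.+1 - j)%N) * 2).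
  rewrite (sym _ (fun j => j%:R)); apply: eq_bigr => j _.
  by rewrite -natrD subnKC // -ltnS.
rewrite big_ord_recl /= !mul0r add0r.
transitivity (\sum_(j < m.+1) (2 * j + 1)%:R * (c j * c (m - j)%N)).
  apply: eq_bigr => j _; rewrite /bump /= add1n subSS.
  by rewrite [in RHS]mulrA -sin_meanS; ring.
have two : (2 : R) != 0 by rewrite pnatr_eq0.
apply: (mulIf two); rewrite !mulr_suml.
rewrite (sym _ (fun j => (2 * j + 1)%:R)); apply: eq_bigr => j _.
rewrite mulrAC -natrD; congr (_ * _).
have lj : (j <= m)%N by rewrite -ltnS.
rewrite -natrM; congr (_%:R).
by lia.
Qed.

Lemma continuous_sinX k : continuous (fun t : R => sin t ^+ k).
Proof.
move=> t; apply: (@continuous_comp _ _ _ (@sin R) (fun x => x ^+ k)).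
  exact: continuous_sin.
exact: exprn_continuous.
Qed.

Lemma integrable_continuous (g : R -> R) : continuous g ->
  mu.-integrable period (EFin \o g).
Proof.
move=> cg; apply: continuous_compact_integrable; first exact: segment_compact.
exact: continuous_subspaceT.
Qed.

(** The recurrence comes from integrating the derivative of [sin^(2m+1) cos], a
    periodic function, over a period. *)
Lemma sin_mean_integral m :
  \int[mu]_(t in period) (sin t ^+ (2 * m)) = 2 * pi * c m.
Proof.
elim: m => [|m IH].
  under eq_Rintegral do rewrite muln0 expr0.
  rewrite Rintegral_cst //= mulr1 mul1r lebesgue_measure_itv /= lte_fin.
  by rewrite mulr_gt0 ?pi_gt0 //= subr0.
pose F : R -> R := (@sin R) ^+ (2 * m).+1 * (@cos R).
pose f (t : R) := (2 * m + 1)%:R * sin t ^+ (2 * m) -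
  (2 * m + 2)%:R * sin t ^+ (2 * m.+1).
have cf : continuous f.
  by move=> t; apply: cvgB; apply: cvgM; try exact: cvg_cst; exact: continuous_sinX.
have dF (t : R) : is_derive t 1 F (f t).
  apply: is_derive_eq; rewrite /f /GRing.scale /=.
  rewrite fctE addn1 addn2 (_ : (2 * m.+1 = (2 * m).+2)%N); last by lia.
  have E : cos t * cos t = 1 - sin t ^+ 2 by rewrite -expr2 cos2sin2.
  set u := _%:R.
  rewrite (_ : cos t * (u * sin t ^+ (2 * m) * cos t) =
    u * sin t ^+ (2 * m) * (cos t * cos t)); last by ring.
  rewrite E (_ : (2 * m).+2%:R = u + 1) /u; last by rewrite -natr1.
  by rewrite !exprS; ring.
have cF : continuous F.
  move=> t; apply/differentiable_continuous/derivable1_diffP.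
  by have [] := dF t.
have F0 : \int[mu]_(t in period) f t = 0.
  rewrite /Rintegral (@continuous_FTC2 _ f F) //.
  - have E (t : R) : sin t = 0 -> F t = 0.
      by move=> t0; rewrite /F !fctE t0 expr0n mul0r.
    have -> : F (2 * pi) = 0 by apply: E; rewrite mulrC mulr_natr sin2pi.
    by rewrite E ?sin0 //= subr0.
  - by rewrite mulr_gt0 ?pi_gt0.
  - exact: continuous_subspaceT.
  - split; first by move=> t _; have [] := dF t.
      by apply: cvg_at_right_filter; exact: cF.
    by apply: cvg_at_left_filter; exact: cF.
  - by move=> t _; rewrite derive1E; have [_ ->] := dF t.
have cX k (a : R) : continuous (fun t : R => a * sin t ^+ k).
  by move=> t; apply: cvgM; [exact: cvg_cst|exact: continuous_sinX].
have : \int[mu]_(t in period) f t =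
    (2 * m + 1)%:R * (2 * pi * c m) -
    (2 * m + 2)%:R * \int[mu]_(t in period) (sin t ^+ (2 * m.+1)).
  have I k := integrable_continuous (@continuous_sinX k).
  rewrite -IH -!RintegralZl //; try exact: I.
  rewrite -RintegralB //; exact: integrable_continuous (cX _ _).
rewrite F0 => /esym/eqP; rewrite subr_eq0 => /eqP E.
have h : ((2 * m + 2)%:R : R) != 0 by rewrite pnatr_eq0 addn2.
apply: (mulfI h); rewrite -E (_ : (2 * m + 2)%N = (m.+1 * 2)%N); last by lia.
rewrite natrM [RHS](_ : _ = 2 * pi * (m.+1%:R * (c m.+1 * 2))); last by ring.
by rewrite sin_meanS; ring.
Qed.

Lemma sin_series_integral (a : nat -> R) i :
  let g t := \sum_(m < i) a m * sin t ^+ (2 * m) in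
  mu.-integrable period (EFin \o g) /\
  \int[mu]_(t in period) g t = 2 * pi * \sum_(m < i) a m * c m.
Proof.
have cX k (b : R) : continuous (fun t : R => b * sin t ^+ k).
  by move=> t; apply: cvgM; [exact: cvg_cst|exact: continuous_sinX].
elim: i => [|i [I1 I2]] /=.
  under [X in EFin \o X]eq_fun do rewrite big_ord0.
  under eq_Rintegral do rewrite big_ord0.
  split; first by apply: integrable_continuous => t; exact: cvg_cst.
  by rewrite big_ord0 mulr0 Rintegral_cst // mul0r.
under [X in EFin \o X]eq_fun do rewrite big_ord_recr /=.
under eq_Rintegral do rewrite big_ord_recr /=.
have J := integrable_continuous (cX (2 * i)%N (a i)).
split.
  have := integrableD _ I1 J; exact.
rewrite RintegralD // I2 RintegralZl //; last first.
  exact: integrable_continuous (@continuous_sinX _).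
by rewrite sin_mean_integral big_ord_recr /=; ring.
Qed.

End SinMean.
(** * The polar part *)

Section LinearForms.
Variables (R : realType) (A : convAlg R).

Definition scalar_of (g : A -> R) (glin : linear_for *%R g) : {scalar A} :=
  HB.pack g (GRing.isLinear.Build R A R *%R g glin).

(** The linear forms on the finite-dimensional quotient by step [i] separate
    its points: a spanning family of minimal size is a basis of the quotient,
    and its coordinates are such forms. *)
Lemma filt_separation i (x : A) :
  (forall f : {scalar A}, (forall y, filt i y -> f y = 0) -> f x = 0) ->
  filt i x.
Proof.
move=> hx.
pose spans d := exists b : 'I_d -> A, forall y, exists e : 'I_d -> R,
  filt i (y - \sum_(l < d) e l *: b l).
have ex : exists d, `[< spans d >].
  have [d [b hb]] := conv_findim (convP A) i.
  by exists d; apply/asboolP; exists b.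
case: (ex_minnP ex) => d /asboolP[b hb] dmin.
have indep (e : 'I_d -> R) : filt i (\sum_(l < d) e l *: b l) ->
    forall l, e l = 0.
  move=> he l0; apply/eqP/negP => /negP ne; case: d l0 b hb dmin e he ne =>
    [[]//|d] l0 b hb dmin e he ne.
  (* A relation with a nonzero coefficient at [l0] allows [b l0] to be dropped. *)
  suff /asboolP/dmin : spans d by rewrite ltnn.
  exists (fun l => b (lift l0 l)) => y; have [a ha] := hb y.
  exists (fun l => a (lift l0 l) - a l0 / e l0 * e (lift l0 l)).
  rewrite (bigD1_ord l0) //= in ha; rewrite (bigD1_ord l0) //= in he.
  have h := filtZ (a l0 / e l0) he; have {ha h} := filtD ha h.
  suff -> : \sum_(l < d) (a (lift l0 l) - a l0 / e l0 * e (lift l0 l)) *: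
      b (lift l0 l) = \sum_(l < d) a (lift l0 l) *: b (lift l0 l) -
      (a l0 / e l0) *: \sum_(l < d) e (lift l0 l) *: b (lift l0 l).
    rewrite scalerDr scalerA divfK //; set p := a l0 *: _.
    set SA := \sum_(l < d) _; set SE := _ *: _.
    by rewrite -addrA [p + SA]addrC opprD -(addrA (- SA)) addKr opprB addrC [- SA + SE]addrC addrC.
  rewrite scaler_sumr -sumrB.
  by apply: eq_bigr => l _; rewrite scalerBl scalerA.
have [co hco] := choice hb.
have uniq y e : filt i (y - \sum_(l < d) e l *: b l) -> co y =1 e.
  move=> he l; apply/eqP; rewrite -subr_eq0; apply/eqP.
  apply: (indep (fun l => co y l - e l)).
  have -> : \sum_(l < d) (co y l - e l) *: b l =
      \sum_(l < d) co y l *: b l - \sum_(l < d) e l *: b l.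
    by rewrite -sumrB; apply: eq_bigr => m _; rewrite scalerBl.
  by apply: (@eqm_trans _ _ _ y) => //; apply: filtBC.
have colin l : linear_for *%R (fun y => co y l).
  move=> a y z; apply: (uniq _ (fun l => a * co y l + co z l)).
  have -> : \sum_(l0 < d) (a * co y l0 + co z l0) *: b l0 =
      a *: (\sum_(l < d) co y l *: b l) + \sum_(l < d) co z l *: b l.
    rewrite scaler_sumr -big_split; apply: eq_bigr => m _ /=.
    by rewrite scalerDl scalerA.
  by apply: eqmD => //; exact: eqmZ.
rewrite -[x]subr0; apply: eqm_trans (hco x) _; rewrite subr0.
rewrite big1; first exact: filt0.
move=> l _; have /= -> := hx (scalar_of (colin l)); first by rewrite scale0r.
move=> y hy /=; apply: (uniq _ (fun=> 0)); rewrite big1 ?subr0 // => m _.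
by rewrite scale0r.
Qed.

End LinearForms.

Section Polarization.
Variables (R : realType) (A : convAlg R).
Implicit Types (H P Q N S : A).

Lemma is_pol_uniq H P P' : is_pol H P -> is_pol H P' -> P = P'.
Proof.
move=> [_ h] [_ h']; apply: filt_eq => i; apply: filt_separation => f hf.
by rewrite linearB /= (h i f hf).2 (h' i f hf).2 subrr.
Qed.

Definition isqrt_coef (m : nat) : R := (-1) ^+ m * sin_mean R m.

(** Modulo step [i], the integrand is a polynomial in [sin t ^ 2], integrated
   term by term. *)
Lemma is_pol_series H N S : filt 1 N -> H * H = - (1 + N) ->
  is_power_series isqrt_coef N S -> is_pol H (H * S).
Proof.
move=> hN hH hS.
have den (t : R) : pol_den H t = 1 + sin t ^+ 2 *: N.
  rewrite /pol_den (expr2 H) hH scalerN opprK scalerDr addrA -scalerDl.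
  by rewrite cos2Dsin2 scale1r.
have hsN (t : R) : filt 1 (sin t ^+ 2 *: N) by exact: filtZ.
have [y hy] := choice (fun t => ps_exists (fun m => (-1) ^+ m) (hsN t)).
have inv t : pol_den H t * y t = 1 /\ y t * pol_den H t = 1.
  by rewrite den; exact: geometric_inv.
split=> [t|i f hf g]; first by exists (y t).
pose a m := (-1) ^+ m * f (H * N ^+ m).
have fE (u v : A) : filt i (u - v) -> f u = f v.
  by move=> /hf; rewrite linearB /= => /eqP; rewrite subr_eq0 => /eqP.
have gE : g = fun t => \sum_(m < i) a m * sin t ^+ (2 * m).
  apply/funext => t; rewrite /g (ainvP (inv t).1 (inv t).2).
  rewrite (fE _ (H * \sum_(m < i) (-1) ^+ m *: (sin t ^+ 2 *: N) ^+ m)).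
    rewrite mulr_sumr linear_sum; apply: eq_bigr => m _ /=.
    by rewrite exprZn scalerA -scalerAr linearZ /= -exprM /a; ring.
  by apply: eqmM; [exact: eqm_refl|exact: hy].
have [I1 I2] := sin_series_integral a i.
rewrite gE; split; first exact: I1.
rewrite I2 (fE _ (H * \sum_(m < i) isqrt_coef m *: N ^+ m)); last first.
  by apply: eqmM; [exact: eqm_refl|exact: hS].
rewrite mulrA mulVf ?mul1r; last by rewrite mulf_neq0 ?pnatr_eq0 // gt_eqF ?pi_gt0.
rewrite mulr_sumr linear_sum; apply: eq_bigr => m _ /=.
by rewrite -scalerAr linearZ /= /a /isqrt_coef; ring.
Qed.

Lemma isqrt_square N S : filt 1 N -> is_power_series isqrt_coef N S ->
  (1 + N) * (S * S) = 1.
Proof.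
move=> hN hS; have := is_power_seriesM hN hS hS.
have -> : conv_prod isqrt_coef isqrt_coef = fun m => (-1) ^+ m.
  apply/funext => m; transitivity ((-1) ^+ m * conv_prod (sin_mean R) (sin_mean R) m).
    rewrite /conv_prod mulr_sumr; apply: eq_bigr => j _.
    have -> : (-1) ^+ m = (-1) ^+ j * (-1) ^+ (m - j) :> R.
      by rewrite -exprD subnKC // -ltnS.
    by rewrite /isqrt_coef; ring.
  by rewrite sin_mean_square mulr1.
by move=> /(geometric_inv hN)[].
Qed.

(** The coefficients are those of [(1 + N) ^ (-1/2)], so that the polar part is
    [H (- H^2) ^ (-1/2)], whose square is -1. *)
Lemma is_pol_near H Q : Q * Q = -1 -> filt 1 (H - Q) ->
  let N := - (H * H) - 1 in
  exists S, [/\ filt 1 N, is_power_series isqrt_coef N S, is_pol H (H * S),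
    (H * S) * (H * S) = -1 & filt 1 (H * S - Q)].
Proof.
move=> sq hHQ N.
have hN : filt 1 N.
  have -> : N = - (H * H - Q * Q) by rewrite /N sq opprB addrC.
  by apply/filtN/eqmM.
have [S hS] := ps_exists isqrt_coef hN.
have hH : H * H = - (1 + N) by rewrite /N addrC subrK opprK.
exists S; split=> //; first exact: is_pol_series hS.
  have HS : H * S = S * H.
    apply: (ps_comm hS); rewrite /N mulrBr mulrBl mulrN mulNr mulrA mulr1 mul1r.
    by [].
  by rewrite -mulrA (mulrA S) -HS !mulrA -(mulrA _ S S) hH mulNr isqrt_square.
rewrite -[X in _ - X]mulr1; apply: eqmM => //.
by have := hS 1%N; rewrite big_ord1 expr0 /isqrt_coef expr0 mul1r scale1r.
Qed.

End Polarization.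
(** * Gram-Schmidt orthogonalization *)

(** Both the ratios [(X/Q)^i_j] and the arguments of pol in the Gram-Schmidt
    procedure have this form. *)
Definition splits (R : realType) (n : nat) (A : convAlg R) (e : 'I_n -> bool)
    (Q : 'I_n -> A) (s : seq 'I_n) (Y : A) : A :=
  foldl (fun Z h => csplit (e h) (Q h) Z) Y s.

Section IteratedSplitting.
Variables (R : realType) (n : nat) (A : convAlg R).
Implicit Types (e b : 'I_n -> bool) (Q : 'I_n -> A) (s : seq 'I_n) (X Y G : A).

Lemma splits0 e Q s : splits e Q s 0 = 0.
Proof. by elim: s => //= h s IH; rewrite csplit0. Qed.

Lemma splitsD e Q s X Y : splits e Q s (X + Y) = splits e Q s X + splits e Q s Y.
Proof. by elim: s X Y => //= h s IH X Y; rewrite csplitD IH. Qed.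

Lemma splits_sum e Q s (I : Type) (r : seq I) (P : pred I) (f : I -> A) :
  splits e Q s (\sum_(l <- r | P l) f l) = \sum_(l <- r | P l) splits e Q s (f l).
Proof. exact: (big_morph _ (splitsD e Q s) (splits0 e Q s)). Qed.

Lemma splits_eigen e b Q s X : (forall h, h \in s -> Q h * Q h = -1) ->
  (forall h, h \in s -> scomm (b h) (Q h) X) ->
  splits e Q s X = if all (fun h => e h == b h) s then X else 0.
Proof.
elim: s => //= h s IH sq hX.
rewrite (csplit_scomm _ (sq _ _) (hX h _)) ?mem_head //.
case: eqP => _ /=; last by rewrite splits0.
by apply: IH => g gs; [apply: sq|apply: hX]; rewrite in_cons gs orbT.
Qed.

Lemma splits_keep c e Q s G X : (forall h, h \in s -> Q h * Q h = -1) ->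
  (forall h, h \in s -> scomm true G (Q h)) -> scomm c G X ->
  scomm c G (splits e Q s X).
Proof.
elim: s X => //= h s IH X sq hG hX.
apply: IH => [g gs|g gs|]; [apply: sq|apply: hG|].
- by rewrite in_cons gs orbT.
- by rewrite in_cons gs orbT.
- by apply: csplit_keep => //; [apply: sq|apply: hG]; exact: mem_head.
Qed.

Lemma scomm_splits e Q s X : uniq s -> (forall h, h \in s -> Q h * Q h = -1) ->
  {in s &, forall g h, g != h -> scomm true (Q g) (Q h)} ->
  forall h, h \in s -> scomm (e h) (Q h) (splits e Q s X).
Proof.
elim: s X => //= g s IH X /andP[gs us] sq ac h; rewrite in_cons.
have sq' k : k \in s -> Q k * Q k = -1 by move=> ks; apply: sq; rewrite in_cons ks orbT.
case/predU1P => [->|hs].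
  apply: splits_keep => // [k ks|].
    by apply: ac; rewrite ?mem_head ?in_cons ?ks ?orbT //; apply: contraNneq gs => ->.
  by apply: scomm_csplit; apply: sq; exact: mem_head.
by apply: IH => // k l ks ls; apply: ac; rewrite in_cons ?ks ?ls orbT.
Qed.

Lemma splitsMr b e Q s X C : (forall h, h \in s -> Q h * Q h = -1) ->
  (forall h, h \in s -> scomm (b h) (Q h) C) ->
  splits e Q s (X * C) = splits (fun h => e h (+) b h) Q s X * C.
Proof.
elim: s X => //= h s IH X sq hC.
rewrite (csplitMr _ _ (sq _ (mem_head _ _)) (hC _ (mem_head _ _))).
by apply: IH => g gs; [apply: sq|apply: hC]; rewrite in_cons gs orbT.
Qed.

Lemma eqm_splits i e Q Q' s X X' :
  (forall h, h \in s -> [/\ Q h * Q h = -1, Q' h * Q' h = -1 & filt i (Q h - Q' h)]) ->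
  filt i (X - X') -> filt i (splits e Q s X - splits e Q' s X').
Proof.
elim: s X X' => //= h s IH X X' hQ hX; apply: IH.
  by move=> g gs; apply: hQ; rewrite in_cons gs orbT.
by have [sq sq' near] := hQ h (mem_head _ _); exact: eqm_csplit.
Qed.

Lemma eq_splits e Q Q' s X : {in s, Q =1 Q'} -> splits e Q s X = splits e Q' s X.
Proof.
elim: s X => //= h s IH X E; rewrite E ?mem_head //; apply: IH.
by move=> g gs; apply: E; rewrite in_cons gs orbT.
Qed.

Lemma eq_splits_sign e e' Q s X : {in s, e =1 e'} -> splits e Q s X = splits e' Q s X.
Proof.
elim: s X => //= h s IH X E; rewrite E ?mem_head //; apply: IH.
by move=> g gs; apply: E; rewrite in_cons gs orbT.
Qed.

Lemma splits_cat e Q s t X : splits e Q (s ++ t) X = splits e Q t (splits e Q s X).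
Proof. exact: foldl_cat. Qed.

End IteratedSplitting.

Definition below n (k : 'I_n) : seq 'I_n := [seq h : 'I_n <- enum 'I_n | (h < k)%N].

Lemma enum_below n (k : 'I_n) :
  enum 'I_n = below k ++ k :: drop k.+1 (enum 'I_n).
Proof.
have kn : (k < size (enum 'I_n))%N by rewrite size_enum_ord.
rewrite -{1}(cat_take_drop k (enum 'I_n)) (drop_nth k kn) nth_ord_enum.
congr (_ ++ _); apply: (inj_map val_inj); rewrite map_take val_enum_ord.
rewrite /below -(filter_map val (fun h => (h < k)%N)) val_enum_ord.
have kn' := ltnW (ltn_ord k).
by rewrite (filter_iota_ltn 0 kn') take_iota (minn_idPl kn').
Qed.

Lemma mem_below n (k h : 'I_n) : (h \in below k) = (h < k)%N.
Proof. by rewrite mem_filter mem_enum andbT. Qed.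

(** The element whose polar part is the [k]th entry of O^GS. *)
Definition gs_residue (R : realType) n (A : convAlg R) (X Q : 'I_n -> A) (k : 'I_n) :=
  splits xpredT Q (below k) (X k).

Section GramSchmidt.
Variables (R : realType) (n : nat) (A : convAlg R).
Implicit Types (Q X : 'I_n -> A) (k : 'I_n) (m : nat).

Definition clifford_upto m Q := forall i j : 'I_n, (i < m)%N -> (j < m)%N ->
  Q i * Q i = -1 /\ (i != j -> scomm true (Q i) (Q j)).

(** The residue is close to [Q0 k] because splitting along [Q h] is close to
    splitting along [Q0 h], which fixes [Q0 k]; it anticommutes with the earlier
    entries, and so does its polar part. *)
Lemma gs_step X Q0 Q k : near_clifford X Q0 -> clifford_upto k Q ->
  (forall h : 'I_n, (h < k)%N -> filt 1 (Q h - Q0 h)) ->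
  let H := gs_residue X Q k in
  filt 1 (- (H * H) - 1) /\ exists S, [/\ is_power_series (@isqrt_coef R) (- (H * H) - 1) S,
    is_pol H (H * S), (H * S) * (H * S) = -1, filt 1 (H * S - Q0 k) &
    forall h : 'I_n, (h < k)%N -> scomm true (Q h) (H * S)].
Proof.
move=> [cQ0 nX] cQ nQ H.
have [sq0 ac0] := (cliffordP Q0).1 cQ0.
have sq h : h \in below k -> Q h * Q h = -1.
  by rewrite mem_below => hk; exact: (cQ h h hk hk).1.
have HQ0 : filt 1 (H - Q0 k).
  have E : splits xpredT Q0 (below k) (Q0 k) = Q0 k.
    rewrite (@splits_eigen _ _ _ _ xpredT) //.
      by rewrite (@eq_all _ _ xpredT) ?all_predT.
    move=> h; rewrite mem_below => hk; apply: ac0.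
    by apply: contraTneq hk => ->; rewrite ltnn.
  rewrite -[X in _ - X]E; apply: eqm_splits => // h hk; split=> //; first exact: sq.
  by apply: nQ; rewrite -mem_below.
have [S [hN hS polS sqS nS]] := is_pol_near (sq0 k) HQ0.
split=> //; exists S; split=> // h hk.
have hH : scomm true (Q h) H.
  apply: (@scomm_splits _ _ _ xpredT); rewrite ?mem_below //.
    by rewrite filter_uniq // enum_uniq.
  by move=> g l; rewrite !mem_below => gk lk; exact: (cQ g l gk lk).2.
have hS' : scomm false (Q h) S.
  rewrite /scomm scale1r; apply: (ps_comm hS).
  have := scommM hH hH; rewrite /scomm scale1r => E.
  by rewrite mulrBr mulrBl mulrN mulNr E mulr1 mul1r.
exact: scommM hH hS'.
Qed.

Lemma is_OGS_upto X Q0 Q m : near_clifford X Q0 -> (m <= n)%N ->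
  (forall k, (k < m)%N -> is_pol (gs_residue X Q k) (Q k)) ->
  clifford_upto m Q /\ forall k, (k < m)%N -> filt 1 (Q k - Q0 k).
Proof.
move=> nX; elim: m => [|m IH] lem hQ; first by split.
have [|cm nm] := IH (ltnW lem); first by move=> k km; apply: hQ; exact: ltnW.
pose k := Ordinal lem; have [_ [S [_ polS sqS nS acS]]] := gs_step (k := k) nX cm nm.
have QkE : Q k = gs_residue X Q k * S.
  by apply: is_pol_uniq polS; apply: hQ; exact: ltnSn.
rewrite -QkE in sqS nS acS.
have case_k (i : 'I_n) : (i < m.+1)%N -> i = k \/ (i < m)%N.
  by rewrite ltnS leq_eqVlt => /orP[/eqP im|]; [left; exact: val_inj|right].
split.
  move=> i j /case_k[->|im] /case_k[->|jm]; split=> //.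
  - by rewrite eqxx.
  - by move=> _; apply: scomm_sym; exact: acS.
  - exact: (cm i i im im).1.
  - by move=> _; exact: acS.
  - exact: (cm i i im im).1.
  - exact: (cm i j im jm).2.
by move=> i /case_k[->|im] //; exact: nm.
Qed.

Lemma is_OGS_near X Q0 Q : near_clifford X Q0 -> is_OGS X Q ->
  near_clifford X Q /\ forall k, filt 1 (Q k - Q0 k).
Proof.
move=> nX hQ; have [|c near] := @is_OGS_upto X Q0 Q n nX (leqnn n).
  by move=> k _; exact: hQ.
have cQ : clifford Q.
  apply/cliffordP; split=> [i|i j]; first exact: (c i i (ltn_ord i) (ltn_ord i)).1.
  exact: (c i j (ltn_ord i) (ltn_ord j)).2.
split=> [|k]; last exact: near.
split=> // k; apply: (eqm_trans (nX.2 k)); apply: filtBC; exact: near.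
Qed.

Lemma is_OGS_series X Q0 Q : near_clifford X Q0 -> is_OGS X Q -> forall k,
  let H := gs_residue X Q k in
  exists S, [/\ filt 1 (- (H * H) - 1),
    is_power_series (@isqrt_coef R) (- (H * H) - 1) S & Q k = H * S].
Proof.
move=> nX hQ k H; have [[cQ _] near] := is_OGS_near nX hQ.
have [sq ac] := (cliffordP Q).1 cQ.
have [|hN [S [hS polS _ _ _]]] := @gs_step X Q0 Q k nX _ (fun h _ => near h).
  by move=> i j _ _; split=> //; exact: ac.
by exists S; split=> //; apply: is_pol_uniq polS; exact: hQ.
Qed.

Lemma eq_gs_residue X Q Q' k : (forall h : 'I_n, (h < k)%N -> Q h = Q' h) ->
  gs_residue X Q k = gs_residue X Q' k.
Proof. by move=> E; apply: eq_splits => h; rewrite mem_below; exact: E. Qed.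

Lemma is_OGS_uniq X Q Q' : is_OGS X Q -> is_OGS X Q' -> Q = Q'.
Proof.
move=> hQ hQ'; suff E m (k : 'I_n) : (k < m)%N -> Q k = Q' k.
  by apply/funext => k; exact: (E n).
elim: m k => // m IH k km; apply: (@is_pol_uniq _ _ (gs_residue X Q k)).
  exact: hQ.
rewrite (@eq_gs_residue _ _ Q'); first exact: hQ'.
by move=> h hk; apply: IH; exact: leq_trans hk _.
Qed.

Lemma is_OGS_exists X Q0 : near_clifford X Q0 -> exists Q, is_OGS X Q.
Proof.
move=> nX; suff E m : (m <= n)%N -> exists Q, forall k : 'I_n, (k < m)%N ->
    is_pol (gs_residue X Q k) (Q k).
  by have [Q hQ] := E n (leqnn n); exists Q => k; exact: hQ.
elim: m => [|m IH] lem; first by exists Q0.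
have [Q hQ] := IH (ltnW lem).
have [cm nm] := is_OGS_upto nX (ltnW lem) hQ.
pose k := Ordinal lem; have [_ [S [_ polS _ _ _]]] := gs_step (k := k) nX cm nm.
exists (fun h => if h == k then gs_residue X Q k * S else Q h) => i im.
rewrite (@eq_gs_residue _ _ Q); last first.
  move=> h hi; case: eqP hi => // -> /=; rewrite ltnNge -ltnS.
  by rewrite im.
case: eqP => [->//|ne]; apply: hQ; move: im; rewrite ltnS leq_eqVlt.
by case/predU1P => // im; case: ne; exact: val_inj.
Qed.

(** The component of [X j / Q j] that commutes with [Q h] for all [h < j] is the
    residue divided by its polar part [Q j], and therefore commutes with [Q j];
    subtracting [Q j / Q j = 1] changes nothing in the anticommuting part. *)
Lemma ratio_OGS X Q0 Q i j : near_clifford X Q0 -> is_OGS X Q ->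
  is_min_supp j i -> ratio Q (fun h => X h - Q h) i j = 0.
Proof.
move=> nX hQ /andP[ij /forallP min].
have [[cQ _] _] := is_OGS_near nX hQ.
have [sq ac] := (cliffordP Q).1 cQ.
have [S [_ hS QE]] := is_OGS_series nX hQ j.
set H := gs_residue X Q j in hS QE.
have HQ : scomm false (Q j) H.
  have e : scomm false H (Q j).
    rewrite QE /scomm scale1r; have HS : H * S = S * H.
      apply: (ps_comm hS); rewrite mulrBr mulrBl mulrN mulNr mulrA mulr1 mul1r.
      by [].
    by rewrite -mulrA -HS.
  exact: scomm_sym e.
rewrite -[ratio _ _ _ _]/(splits i Q (enum 'I_n) ((X j - Q j) * ainv (Q j))).
rewrite ainv_sqN1 // mulrN mulrBl sq opprB addrC -mulrN (enum_below j) splits_cat /=.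
suff -> : csplit (i j) (Q j) (splits i Q (below j) (X j * - Q j + -1)) = 0.
  by rewrite splits0.
have bel h : h \in below j -> i h = false.
  rewrite mem_below => hj; apply: contraTF hj => ih.
  by rewrite -leqNgt; exact: (implyP (min h)).
have acb h : h \in below j -> scomm true (Q h) (- Q j).
  rewrite mem_below => hj; apply/scommN/ac.
  by apply: contraTneq hj => ->; rewrite ltnn.
have sqb h : h \in below j -> Q h * Q h = -1 by [].
have -> : splits i Q (below j) (X j * - Q j + -1) = H * - Q j - 1.
  rewrite splitsD (splitsMr _ _ sqb acb); congr (_ * _ + _).
    by apply: eq_splits_sign => h /bel ->.
  rewrite (@splits_eigen _ _ _ _ xpred0) // => [|h _].
    by rewrite (@eq_in_all _ _ xpredT) ?all_predT // => h /bel ->.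
  exact/scommN/scomm1.
rewrite (@csplit_scomm _ _ false) ?ij //.
apply: scommD; last exact/scommN/scomm1.
exact: scommM HQ (scommN (scomm_refl _)).
Qed.

End GramSchmidt.
(** * Naturality and sign changes *)

Section Naturality.
Variables (R : realType) (n : nat) (A B : convAlg R) (phi : {lrmorphism A -> B}).
Hypothesis phi_filt : filt_hom phi.
Implicit Types (Q X : 'I_n -> A).

Lemma filt_homB i x y : filt i (x - y) -> filt i (phi x - phi y).
Proof. by move=> h; rewrite -linearB; exact: phi_filt. Qed.

Lemma filt_sum_hom (u : nat -> A) S :
  filt_sum u S -> filt_sum (fun r => phi (u r)) (phi S).
Proof.
move=> h i; have [N hN] := h i; exists N => m /hN/filt_homB.
by rewrite linear_sum.
Qed.

Lemma clifford_hom Q : clifford Q -> clifford (phi \o Q).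
Proof.
case/cliffordP => sq ac; apply/cliffordP; split=> [i|i j ne] /=.
  by rewrite -rmorphM /= sq rmorphN1.
by have := ac i j ne; rewrite /scomm -rmorphM /= => ->; rewrite linearZ rmorphM.
Qed.

Lemma near_clifford_hom X Q : near_clifford X Q ->
  near_clifford (phi \o X) (phi \o Q).
Proof. by case=> /clifford_hom cQ nX; split=> // k; exact: filt_homB. Qed.

Lemma splits_hom e Q s Y : (forall h, Q h * Q h = -1) ->
  phi (splits e Q s Y) = splits e (phi \o Q) s (phi Y).
Proof. by move=> sq; elim: s Y => //= h s IH Y; rewrite IH csplit_hom. Qed.

(** A linear form on the target pulls back to one on the source, with the same
    integrand. *)
Lemma is_pol_hom H P : is_pol H P -> is_pol (phi H) (phi P).
Proof.
have denE (t : R) : pol_den (phi H) t = phi (pol_den H t).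
  by rewrite /pol_den linearB /= !linearZ /= rmorphXn rmorph1; congr (_ + _ *: _).
move=> [inv hP]; split=> [t|i f hf].
  have [y [h1 h2]] := inv t; exists (phi y).
  by rewrite denE -!rmorphM /= h1 h2 rmorph1.
have glin : linear_for *%R (fun x : A => f (phi x)).
  by move=> a x y; rewrite !linearP.
have [|I1 I2] := hP i (scalar_of glin).
  by move=> x hx; apply: hf; exact: phi_filt.
suff -> : (fun t => f (phi H * ainv (pol_den (phi H) t))) =
          (fun t => f (phi (H * ainv (pol_den H t)))) by split.
apply/funext => t; have [y [h1 h2]] := inv t.
rewrite denE (ainvP h1 h2) (@ainvP _ _ _ (phi y)) ?rmorphM //.
- by rewrite -rmorphM h1 rmorph1.
- by rewrite -rmorphM h2 rmorph1.
Qed.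

Lemma is_OGS_hom X Q : (forall h, Q h * Q h = -1) -> is_OGS X Q ->
  is_OGS (phi \o X) (phi \o Q).
Proof.
move=> sq hQ k; have := is_pol_hom (hQ k).
by rewrite -[foldl _ _ _]/(splits xpredT Q (below k) (X k)) splits_hom.
Qed.

Lemma ratio_hom Q X i j : (forall h, Q h * Q h = -1) ->
  phi (ratio Q X i j) = ratio (phi \o Q) (phi \o X) i j.
Proof.
move=> sq; rewrite -[ratio Q _ _ _]/(splits i Q (enum 'I_n) (X j * ainv (Q j))).
rewrite splits_hom // rmorphM /= ainv_sqN1 // rmorphN /= -ainv_sqN1 //.
by rewrite -rmorphM /= sq rmorphN1.
Qed.

Lemma ratio_word_hom Q X r (w : word n r) : (forall h, Q h * Q h = -1) ->
  phi (ratio_word Q X w) = ratio_word (phi \o Q) (phi \o X) w.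
Proof. by move=> sq; rewrite rmorph_prod; apply: eq_bigr => l _; exact: ratio_hom. Qed.

Lemma mpow_hom Q i : phi (mpow Q i) = mpow (phi \o Q) i.
Proof. by rewrite rmorph_prod; apply: eq_bigr => h _; rewrite rmorphXn. Qed.

Lemma gs_term_hom (p : gs_coef R n) Q X k r : (forall h, Q h * Q h = -1) ->
  phi (gs_term p Q X k r) = gs_term p (phi \o Q) (phi \o X) k r.
Proof.
move=> sq; rewrite linear_sum; apply: eq_bigr => kappa _.
rewrite linear_sum; apply: eq_bigr => w _.
by rewrite linearZ !rmorphM /= ratio_word_hom // mpow_hom.
Qed.

End Naturality.

Section Signs.
Variables (R : realType) (n : nat) (A : convAlg R) (d : 'I_n -> bool).
Implicit Types (Q X : 'I_n -> A).

Local Notation sg := (fun Z : 'I_n -> A => fun h => (-1) ^+ d h *: Z h).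

Lemma clifford_sign Q : clifford Q -> clifford (sg Q).
Proof.
case/cliffordP => sq ac; apply/cliffordP; split=> [i|i j ne].
  by rewrite -scalerAl -scalerAr scalerA -signr_addb addbb scale1r.
by apply: scommZ; apply: scomm_sym; apply: scommZ; apply: scomm_sym; exact: ac.
Qed.

Lemma near_clifford_sign X Q : near_clifford X Q -> near_clifford (sg X) (sg Q).
Proof. by case=> /clifford_sign cQ nX; split=> // k; exact: eqmZ. Qed.

Lemma splits_sign e Q s Y : (forall h, Q h * Q h = -1) ->
  splits e (sg Q) s Y = splits e Q s Y.
Proof. by move=> sq; elim: s Y => //= h s IH Y; rewrite IH csplit_sign. Qed.

Lemma splitsZ e Q s (a : R) Y : splits e Q s (a *: Y) = a *: splits e Q s Y.
Proof. by elim: s Y => //= h s IH Y; rewrite csplitZ IH. Qed.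

Lemma is_pol_sign (b : bool) (H P : A) : is_pol H P ->
  is_pol ((-1) ^+ b *: H) ((-1) ^+ b *: P).
Proof.
have denE (t : R) : pol_den ((-1) ^+ b *: H) t = pol_den H t.
  by rewrite /pol_den exprZn sqrr_sign scale1r.
move=> [inv hP]; split=> [t|i f hf]; first by rewrite denE; exact: inv.
have glin : linear_for *%R (fun x : A => f ((-1) ^+ b *: x)).
  by move=> a x y; rewrite !linearP /= !linearZ /=; ring.
have [|I1 I2] := hP i (scalar_of glin).
  by move=> x hx; apply: hf; exact: filtZ.
suff -> : (fun t => f ((-1) ^+ b *: H * ainv (pol_den ((-1) ^+ b *: H) t))) =
          (fun t => f ((-1) ^+ b *: (H * ainv (pol_den H t)))) by split.
by apply/funext => t; rewrite denE scalerAl.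
Qed.

Lemma is_OGS_sign X Q : (forall h, Q h * Q h = -1) -> is_OGS X Q ->
  is_OGS (sg X) (sg Q).
Proof.
move=> sq hQ k; have := is_pol_sign (d k) (hQ k).
rewrite -[foldl _ _ _]/(splits xpredT Q (below k) (X k)).
rewrite -[X in _ -> is_pol X _]/(splits xpredT (sg Q) (below k) (sg X k)).
by rewrite splits_sign // splitsZ.
Qed.

Lemma ratio_sign Q X i j : (forall h, Q h * Q h = -1) ->
  ratio (sg Q) (sg X) i j = ratio Q X i j.
Proof.
move=> sq.
have sq' h : sg Q h * sg Q h = -1.
  by rewrite -scalerAl -scalerAr scalerA -signr_addb addbb scale1r.
rewrite -[LHS]/(splits i (sg Q) (enum 'I_n) (sg X j * ainv (sg Q j))).
rewrite splits_sign // !ainv_sqN1 // -scalerN -scalerAl -scalerAr scalerA.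
by rewrite -signr_addb addbb scale1r -ainv_sqN1.
Qed.

Lemma mpow_sign Q i : mpow (sg Q) i =
  (\prod_(h < n) (-1) ^+ (d h && i h)) *: mpow Q i.
Proof.
rewrite /mpow; elim/big_rec3: _ => [|h x y z _ ->]; first by rewrite scale1r.
have -> : ((-1) ^+ d h *: Q h) ^+ i h = (-1) ^+ (d h && i h) *: Q h ^+ i h.
  by case: (i h); rewrite ?andbT ?andbF ?expr1 // !expr0 scale1r.
by rewrite -scalerAl -scalerAr scalerA.
Qed.

End Signs.
(** * Families of elements spanned by universal monomials *)

Section MonomialRelations.
Variables (R : realType) (n : nat) (A : convAlg R) (Q : 'I_n -> A).
Hypothesis cQ : clifford Q.

Let sq : forall h, Q h * Q h = -1 := clifford_sq cQ.

Lemma scomm_ratio (X : 'I_n -> A) (i : multi n) j h :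
  scomm (i h) (Q h) (ratio Q X i j).
Proof.
apply: (@scomm_splits _ _ _ i); rewrite ?enum_uniq ?mem_enum //.
by move=> g l _ _; exact: clifford_anti.
Qed.

Lemma scomm_prod (I : Type) (s : seq I) (b : I -> bool) (f : I -> A) h :
  (forall l, scomm (b l) (Q h) (f l)) ->
  scomm (\big[addb/false]_(l <- s) b l) (Q h) (\prod_(l <- s) f l).
Proof.
move=> hf; elim: s => [|l s IH]; first by rewrite !big_nil; exact: scomm1.
by rewrite !big_cons; exact: scommM.
Qed.

Lemma scomm_mpow (b : 'I_n -> bool) (i : multi n) Y :
  (forall h, scomm (b h) (Q h) Y) ->
  mpow Q i * Y = (\prod_(h < n) (-1) ^+ (b h && i h)) *: (Y * mpow Q i).
Proof.
move=> hY; rewrite /mpow.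
elim/big_rec2: _ => [|h x y _ IH]; first by rewrite mul1r mulr1 scale1r.
have E : Q h ^+ i h * Y = (-1) ^+ (b h && i h) *: (Y * Q h ^+ i h).
  case: (i h); rewrite ?andbT ?andbF ?expr1; first exact: hY.
  by rewrite !expr0 mul1r mulr1 scale1r.
rewrite -mulrA IH -scalerAr (mulrA _ Y) E -scalerAl scalerA mulrC.
by rewrite -(mulrA Y).
Qed.

Definition flip (i : multi n) (h : 'I_n) : multi n :=
  [ffun g => if g == h then ~~ i g else i g].

Definition flip_sign (i : multi n) (h : 'I_n) : R :=
  (\prod_(g <- below h) (-1) ^+ i g) * (-1) ^+ i h.

Lemma mpowE (i : multi n) : mpow Q i = \prod_(h <- enum 'I_n) Q h ^+ i h.
Proof. by rewrite /mpow enumT [index_enum _]unlock. Qed.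

(** Moving [Q h] to its place costs one sign per generator before it, and one
    more if it then meets itself. *)
Lemma mul_mpow (i : multi n) h : Q h * mpow Q i = flip_sign i h *: mpow Q (flip i h).
Proof.
rewrite !mpowE (enum_below h) !big_cat !big_cons /= mulrA.
have hb : h \notin below h by rewrite mem_below ltnn.
have hd : h \notin drop h.+1 (enum 'I_n).
  have := enum_uniq 'I_n; rewrite {1}(enum_below h) cat_uniq cons_uniq.
  by case/and4P.
have same (s : seq 'I_n) : h \notin s ->
    \prod_(g <- s) Q g ^+ flip i h g = \prod_(g <- s) Q g ^+ i g.
  move=> hs; apply: eq_big_seq => g gs; rewrite ffunE; case: eqP => // gh.
  by rewrite -gh gs in hs.
rewrite !same // ffunE eqxx.
have -> : Q h * \prod_(g <- below h) Q g ^+ i g =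
    (\prod_(g <- below h) (-1) ^+ i g) *: (\prod_(g <- below h) Q g ^+ i g * Q h).
  elim: (below h) hb => [|g s IH]; first by rewrite !big_nil mul1r mulr1 scale1r.
  rewrite in_cons negb_or => /andP[ne hs]; rewrite !big_cons mulrA.
  have -> : Q h * Q g ^+ i g = (-1) ^+ i g *: (Q g ^+ i g * Q h).
    case: (i g); last by rewrite !expr0 mul1r mulr1 scale1r.
    by rewrite !expr1; exact: clifford_anti.
  by rewrite -scalerAl -(mulrA _ (Q h)) IH // -scalerAr scalerA -!mulrA.
rewrite /flip_sign -scalerA -scalerAl; congr (_ *: _).
rewrite -!mulrA scalerAr scalerAl; congr (_ * _); rewrite mulrA; congr (_ * _).
case: (i h) => /=; last by rewrite expr0 mulr1 expr1 scale1r.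
by rewrite !expr1 sq expr0 scaleN1r.
Qed.

Lemma mpow0 : mpow Q [ffun=> false] = 1.
Proof. by rewrite /mpow big1 // => h _; rewrite ffunE. Qed.

End MonomialRelations.

(** The sign and the exponent come before the algebra and the Clifford system:
    this is why products of universal monomials are universal. *)
Lemma mpowM (R : realType) n (i j : multi n) : exists (c : R) (k : multi n),
  forall (A : convAlg R) (Q : 'I_n -> A), clifford Q ->
  mpow Q i * mpow Q j = c *: mpow Q k.
Proof.
suff E (s : seq 'I_n) : exists (c : R) (k : multi n),
    forall (A : convAlg R) (Q : 'I_n -> A), clifford Q ->
    (\prod_(h <- s) Q h) * mpow Q j = c *: mpow Q k.
  have [c [k hk]] := E [seq h : 'I_n <- enum 'I_n | i h].
  exists c, k => A Q /hk <-; rewrite mpowE; congr (_ * _).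
  by rewrite big_filter [in RHS]big_mkcond; apply: eq_bigr => h _; case: (i h).
elim: s => [|h s [c [k IH]]].
  by exists 1, j => A Q _; rewrite big_nil mul1r scale1r.
exists (c * flip_sign R k h), (flip k h) => A Q cQ.
by rewrite big_cons -mulrA IH // -scalerAr mul_mpow // scalerA.
Qed.

Section Families.
Variables (R : realType) (n : nat).

(** A construction that makes sense in all algebras at once. Quantifying over the
    algebra inside is what makes expansion coefficients universal. *)
Definition family := forall A : convAlg R, ('I_n -> A) -> ('I_n -> A) -> A.

Definition admissible (A : convAlg R) (Q X : 'I_n -> A) :=
  clifford Q /\ forall j, filt 1 (X j).

Implicit Types (a b : family) (r s : nat).

(** Covers two situations: congruence modulo a step of the filtration, where
    [S r] is the same for all [r], and exact homogeneous expressions, where [r]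
    counts the factors [X j]. *)
Record graded_closed (S : nat -> family -> Prop) : Prop := {
  gr_ext : forall r a b, (forall A Q X, admissible Q X -> a A Q X = b A Q X) ->
    S r a -> S r b;
  gr_0 : forall r, S r (fun A Q X => 0);
  gr_1 : S 0%N (fun A Q X => 1);
  gr_D : forall r a b, S r a -> S r b -> S r (fun A Q X => a A Q X + b A Q X);
  gr_Z : forall r (c : R) a, S r a -> S r (fun A Q X => c *: a A Q X);
  gr_M : forall r s a b, S r a -> S s b -> S (r + s)%N (fun A Q X => a A Q X * b A Q X)
}.

Section GradedClosed.
Variables (S : nat -> family -> Prop) (hS : graded_closed S).

Lemma gr_N r a : S r a -> S r (fun A Q X => - a A Q X).
Proof.
move=> /(gr_Z hS (-1)); apply: (gr_ext hS) => A Q X _; exact: scaleN1r.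
Qed.

Lemma gr_sum r (I : Type) (t : seq I) (P : pred I) (f : I -> family) :
  (forall l, S r (f l)) -> S r (fun A Q X => \sum_(l <- t | P l) f l A Q X).
Proof.
move=> hf; elim: t => [|l t IH].
  by apply: (gr_ext hS) (gr_0 hS r) => A Q X _; rewrite big_nil.
have [Pl|Pl] := boolP (P l).
  by apply: (gr_ext hS) (gr_D hS (hf l) IH) => A Q X _; rewrite big_cons Pl.
by apply: (gr_ext hS) IH => A Q X _; rewrite big_cons (negbTE Pl).
Qed.

Lemma gr_prod (I : Type) (d : nat) (t : seq I) (f : I -> family) :
  (forall l, S d (f l)) ->
  S (size t * d) (fun A Q X => \prod_(l <- t) f l A Q X).
Proof.
move=> hf; elim: t => [|l t IH].
  by apply: (gr_ext hS) (gr_1 hS) => A Q X _; rewrite big_nil.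
by apply: (gr_ext hS) (gr_M hS (hf l) IH) => A Q X _; rewrite big_cons.
Qed.

Variable q : 'I_n -> family.
Hypothesis hq : forall h, S 0%N (q h).
Hypothesis q_sq : forall (A : convAlg R) (Q X : 'I_n -> A), admissible Q X ->
  forall h, q h Q X * q h Q X = -1.

Lemma gr_csplit r e h a : S r a -> S r (fun A Q X => csplit e (q h Q X) (a A Q X)).
Proof.
move=> ha.
have h1 := gr_M hS (gr_M hS (hq h) ha) (hq h); rewrite addn0 add0n in h1.
apply: (gr_ext hS) (gr_Z hS 2^-1 (gr_D hS ha (gr_N (gr_Z hS ((-1) ^+ e) h1)))).
by move=> A Q X /q_sq sq; rewrite csplit_sqN1.
Qed.

Lemma gr_splits r e t a :
  S r a -> S r (fun A Q X => splits e (fun h => q h Q X) t (a A Q X)).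
Proof.
elim: t a => [|h t IH] a ha; first by apply: (gr_ext hS) ha.
by apply: (gr_ext hS) (IH _ (gr_csplit (e h) h ha)).
Qed.

Lemma gr_ratio r (x : 'I_n -> family) i j : (forall j, S r (x j)) ->
  S r (fun A Q X => ratio (fun h => q h Q X) (fun h => x h A Q X) i j).
Proof.
move=> hx; have h1 := gr_M hS (hx j) (gr_N (hq j)); rewrite addn0 in h1.
apply: (gr_ext hS) (gr_splits i (enum 'I_n) h1) => A Q X /q_sq sq.
rewrite -[RHS]/(splits i (fun h => q h Q X) (enum 'I_n) (x j A Q X * ainv (q j Q X))).
by rewrite ainv_sqN1.
Qed.

Lemma gr_ratio_word d (x : 'I_n -> family) r (w : word n r) : (forall j, S d (x j)) ->
  S (r * d) (fun A Q X => ratio_word (fun h => q h Q X) (fun h => x h A Q X) w).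
Proof.
move=> hx; rewrite -{1}(size_tuple w).
apply: (gr_prod w (f := fun l A Q X =>
  ratio (fun h => q h Q X) (fun h => x h A Q X) l.2 l.1)) => l.
exact: gr_ratio.
Qed.

Lemma gr_mpow i : S 0%N (fun A Q X => mpow (fun h => q h Q X) i).
Proof.
rewrite -[0%N](muln0 (size (index_enum 'I_n))).
apply: (gr_prod _ (f := fun h A Q X => q h Q X ^+ i h)) => h.
case: (i h); last by apply: (gr_ext hS) (gr_1 hS).
exact: hq.
Qed.

End GradedClosed.

Section Span.
Variables (I : Type) (M : I -> family) (E : forall A : convAlg R, A -> Prop).
Hypothesis E0 : forall A : convAlg R, E (0 : A).
Hypothesis ED : forall (A : convAlg R) (x y : A), E x -> E y -> E (x + y).
Hypothesis EM : forall (A : convAlg R) (x y z : A), E y -> E (x * y * z).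

Definition lincomb (t : seq (R * I)) : family :=
  fun A Q X => \sum_(c <- t) c.1 *: M c.2 Q X.

(** A single combination has to serve in all algebras. *)
Definition spanned (P : pred I) a : Prop := exists2 t : seq (R * I),
  all (fun c => P c.2) t &
  forall (A : convAlg R) (Q X : 'I_n -> A), admissible Q X -> E (a A Q X - lincomb t Q X).

Implicit Types P : pred I.

Lemma spanned_mod P a b :
  (forall (A : convAlg R) (Q X : 'I_n -> A), admissible Q X -> E (b A Q X - a A Q X)) ->
  spanned P a -> spanned P b.
Proof.
move=> hE [t Pt ht]; exists t => // A Q X ad.
rewrite -(subrK (a A Q X) (b A Q X)) -addrA.
by apply: ED; [exact: hE|exact: ht].
Qed.

Lemma spanned_ext P a b : (forall A Q X, admissible Q X -> a A Q X = b A Q X) ->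
  spanned P a -> spanned P b.
Proof. by move=> h; apply: spanned_mod => A Q X /h ->; rewrite subrr. Qed.

Lemma spanned0 P : spanned P (fun A Q X => 0).
Proof. by exists [::] => // A Q X _; rewrite /lincomb big_nil subrr. Qed.

Lemma spannedD P a b : spanned P a -> spanned P b ->
  spanned P (fun A Q X => a A Q X + b A Q X).
Proof.
move=> [s Ps hs] [t Pt ht]; exists (s ++ t); first by rewrite all_cat Ps.
move=> A Q X ad; rewrite /lincomb big_cat opprD addrACA.
by apply: ED; [exact: hs|exact: ht].
Qed.

Lemma spannedZ P (k : R) a : spanned P a -> spanned P (fun A Q X => k *: a A Q X).
Proof.
move=> [t Pt ht]; exists [seq (k * c.1, c.2) | c <- t].
  by rewrite all_map.
move=> A Q X ad; rewrite /lincomb big_map /=.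
have -> : \sum_(c <- t) (k * c.1) *: M c.2 Q X = k *: lincomb t Q X.
  by rewrite scaler_sumr; apply: eq_bigr => c _; rewrite scalerA.
by rewrite -scalerBr -[k *: _]mulr_algl -[_ * _]mulr1; apply: EM; exact: ht.
Qed.

Lemma spanned_gen P x : P x -> spanned P (M x).
Proof.
move=> Px; exists [:: (1, x)] => /=; first by rewrite Px.
by move=> A Q X _; rewrite /lincomb big_seq1 scale1r subrr.
Qed.

Lemma spanned_lincomb_mul P1 P2 P3 :
  (forall x y, P1 x -> P2 y -> spanned P3 (fun A Q X => M x Q X * M y Q X)) ->
  forall s t : seq (R * I), all (fun c => P1 c.2) s -> all (fun c => P2 c.2) t ->
  spanned P3 (fun A Q X => lincomb s Q X * lincomb t Q X).
Proof.
move=> hM s t; elim: s => [|c s IH] /=.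
  move=> _ _; apply: spanned_ext (spanned0 _) => A Q X _.
  by rewrite /lincomb big_nil mul0r.
move=> /andP[Pc Ps] Pt.
have h1 : spanned P3 (fun A Q X => M c.2 Q X * lincomb t Q X).
  elim: t Pt {IH Ps} => [|d t IH] /=.
    move=> _; apply: spanned_ext (spanned0 _) => A Q X _.
    by rewrite /lincomb big_nil mulr0.
  move=> /andP[Pd Pt].
  apply: spanned_ext (spannedD (spannedZ d.1 (hM _ _ Pc Pd)) (IH Pt)) => A Q X _.
  by rewrite /lincomb big_cons mulrDr scalerAr.
apply: spanned_ext (spannedD (spannedZ c.1 h1) (IH Ps Pt)) => A Q X _.
by rewrite /lincomb [in RHS]big_cons mulrDl scalerAl.
Qed.

Lemma spannedM P1 P2 P3 a b :
  (forall x y, P1 x -> P2 y -> spanned P3 (fun A Q X => M x Q X * M y Q X)) ->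
  spanned P1 a -> spanned P2 b -> spanned P3 (fun A Q X => a A Q X * b A Q X).
Proof.
move=> hM [s Ps hs] [t Pt ht].
apply: spanned_mod (spanned_lincomb_mul hM Ps Pt) => A Q X ad.
rewrite -(subrK (lincomb s Q X * b A Q X) (a A Q X * b A Q X)) -addrA.
rewrite -mulrBl -mulrBr; apply: ED.
  by rewrite -[_ - _]mul1r; apply: EM; exact: hs.
by rewrite -[_ * _]mulr1; apply: EM; exact: ht.
Qed.

End Span.

End Families.
(** * Formal expansions and their coefficients *)

Section Coefficients.
Variables (R : realType) (n : nat).
Local Notation family := (family R n).
Local Notation index := (seq (letter n) * multi n)%type.
Implicit Types (a b : family) (x y : index) (r : nat).

Local Notation zero_multi := ([ffun=> false] : multi n).

Lemma csplit_recon (A : convAlg R) (Q Y : A) :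
  csplit false Q Y + csplit true Q Y = Y.
Proof.
rewrite /csplit -scalerDr expr0 expr1 mul1r mulN1r addrACA subrr addr0.
exact: half_double.
Qed.

(** A family belongs to a graded space as soon as all its iterated components
    do, since it is their sum. *)
Lemma gr_unsplit S r a : graded_closed S ->
  (forall i : multi n,
     S r (fun A Q X => splits i Q (enum 'I_n) (a A Q X))) -> S r a.
Proof.
move=> hS h.
suff E (s : seq 'I_n) : uniq s ->
    (forall e : 'I_n -> bool, S r (fun A Q X => splits e Q s (a A Q X))) -> S r a.
  apply: (E (enum 'I_n)); first exact: enum_uniq.
  move=> e; apply: (gr_ext hS) (h (finfun e)) => A Q X _.
  by apply: eq_splits_sign => g _; rewrite ffunE.
elim/last_ind: s => [_ /(_ xpredT)|s g IH]; first exact: (gr_ext hS).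
rewrite rcons_uniq => /andP[gs us] hs; apply: IH => // e.
pose e_ c := fun l => if l == g then c else e l.
apply: (gr_ext hS) (gr_D hS (hs (e_ false)) (hs (e_ true))) => A Q X _.
have E c : splits (e_ c) Q (rcons s g) (a A Q X) =
    csplit c (Q g) (splits e Q s (a A Q X)).
  rewrite -cats1 splits_cat /= {1}/e_ eqxx; congr csplit.
  by apply: eq_splits_sign => l ls; rewrite /e_; case: eqP ls gs => // -> ->.
by rewrite !E csplit_recon.
Qed.

Definition fq_monomial x : family := fun A Q X =>
  (\prod_(l <- x.1) ratio Q X l.2 l.1) * mpow Q x.2.

Definition an_monomial x : family := fun A Q X =>
  mpow Q x.2 * \prod_(l <- x.1) (X l.1 * mpow Q l.2).

Lemma mpow_flip0 (A : convAlg R) (Q : 'I_n -> A) h : clifford Q ->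
  Q h = flip_sign R zero_multi h *: mpow Q (flip zero_multi h).
Proof. by move=> cQ; rewrite -mul_mpow // mpow0 mulr1. Qed.

Section FQSpan.
Variable i : nat.

Let E (A : convAlg R) (x : A) : Prop := filt i x.

Definition fq_span : nat -> family -> Prop := fun=>
  spanned fq_monomial E xpredT.

Let E0 (A : convAlg R) : E (0 : A). Proof. exact: filt0. Qed.
Let ED (A : convAlg R) (x y : A) : E x -> E y -> E (x + y).
Proof. exact: filtD. Qed.
Let EM (A : convAlg R) (x y z : A) : E y -> E (x * y * z).
Proof. by move=> h; apply/filtMr/filtMl. Qed.

Lemma fq_monomialM x y : fq_span 0 (fun A Q X =>
  fq_monomial x Q X * fq_monomial y Q X).
Proof.
have [c [k hk]] := mpowM R x.2 y.2.
pose b h := \big[addb/false]_(l <- y.1) l.2 h.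
(* [c'] is the sign of moving the first multipower past the second word. *)
pose c' : R := \prod_(h < n) (-1) ^+ (b h && x.2 h).
apply: (spanned_ext E0 ED (a := fun A Q X =>
  (c' * c) *: fq_monomial (x.1 ++ y.1, k) Q X)); last first.
  by apply: (spannedZ EM); exact: (spanned_gen _ E0).
move=> A Q X [cQ _]; rewrite /fq_monomial /= big_cat /=.
set u := \prod_(l <- x.1) _; set v := \prod_(l <- y.1) _.
have Ev : mpow Q x.2 * v = c' *: (v * mpow Q x.2).
  by apply: scomm_mpow => h; apply: scomm_prod => l; exact: scomm_ratio.
rewrite -[RHS]mulrA (mulrA (mpow _ _) v) Ev -scalerAl -(mulrA v (mpow _ _)) hk //.
by rewrite -!scalerAr scalerA mulrA.
Qed.

Lemma fq_span_closed : graded_closed fq_span.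
Proof.
split=> [r a b|r||r a b|r c a|r s a b].
- exact: spanned_ext.
- exact: spanned0.
- apply: (spanned_ext E0 ED (a := fq_monomial ([::], zero_multi))).
    by move=> A Q X _; rewrite /fq_monomial big_nil mpow0 mul1r.
  exact: (spanned_gen _ E0).
- exact: spannedD.
- exact: spannedZ.
- by apply: spannedM => // x y _ _; exact: fq_monomialM.
Qed.

Lemma fq_span_clifford h : fq_span 0 (fun A Q X => Q h).
Proof.
apply: (gr_ext fq_span_closed (a := fun A Q X => flip_sign R zero_multi h *:
    fq_monomial ([::], flip zero_multi h) Q X)).
  by move=> A Q X [cQ _]; rewrite /fq_monomial big_nil mul1r -mpow_flip0.
by apply: (gr_Z fq_span_closed); exact: (spanned_gen _ E0).
Qed.

Lemma fq_span_perturbation j : fq_span 0 (fun A Q X => X j).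
Proof.
have h : fq_span 0 (fun A Q X => X j * ainv (Q j)).
  apply: (gr_unsplit fq_span_closed) => k.
  apply: (gr_ext fq_span_closed (a := fq_monomial ([:: (j, k)], zero_multi))).
    by move=> A Q X _; rewrite /fq_monomial big_seq1 mpow0 mulr1.
  exact: (spanned_gen _ E0).
apply: (gr_ext fq_span_closed) (gr_M fq_span_closed h (fq_span_clifford j)).
move=> A Q X [cQ _]; have sq := clifford_sq cQ j.
by rewrite ainv_sqN1 // mulrN mulNr -mulrA sq mulrN1 opprK.
Qed.

Lemma fq_span_filt r a : (forall (A : convAlg R) (Q X : 'I_n -> A),
  admissible Q X -> filt i (a A Q X)) -> fq_span r a.
Proof.
move=> h; apply: (spanned_mod ED _ (spanned0 _ E0 _)) => A Q X ad.
by rewrite subr0; exact: h.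
Qed.

End FQSpan.

Section AnSpan.
Let E (A : convAlg R) (x : A) : Prop := x = 0.

Definition an_span : nat -> family -> Prop := fun r =>
  spanned an_monomial E (fun x => size x.1 == r).

Let E0 (A : convAlg R) : E (0 : A). Proof. by []. Qed.
Let ED (A : convAlg R) (x y : A) : E x -> E y -> E (x + y).
Proof. by rewrite /E => -> ->; rewrite addr0. Qed.
Let EM (A : convAlg R) (x y z : A) : E y -> E (x * y * z).
Proof. by rewrite /E => ->; rewrite mulr0 mul0r. Qed.

(** The multipower ending the first word merges with the one opening the second
   word. *)
Lemma an_monomialM x y : an_span (size x.1 + size y.1) (fun A Q X =>
  an_monomial x Q X * an_monomial y Q X).
Proof.
case: x => w k /=; case/lastP: w => [|w l].
  have [c [k' hk]] := mpowM R k y.2.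
  apply: (spanned_ext E0 ED (a := fun A Q X => c *: an_monomial (y.1, k') Q X)).
    move=> A Q X [cQ _]; rewrite /an_monomial /= big_nil mulr1 mulrA hk //.
    by rewrite scalerAl.
  by apply: (spannedZ EM); apply: (spanned_gen _ E0).
have [c [k' hk]] := mpowM R l.2 y.2.
apply: (spanned_ext E0 ED (a := fun A Q X =>
    c *: an_monomial (w ++ (l.1, k') :: y.1, k) Q X)).
  move=> A Q X [cQ _].
  rewrite /an_monomial /= -cats1 !big_cat /= !big_cons big_nil mulr1 -!mulrA.
  by rewrite (mulrA (mpow Q l.2)) hk // -scalerAl -!scalerAr.
apply: (spannedZ EM); apply: (spanned_gen _ E0) => /=.
by rewrite size_cat size_rcons /= addSnnS.
Qed.

Lemma an_span_closed : graded_closed an_span.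
Proof.
split=> [r a b|r||r a b|r c a|r s a b].
- exact: spanned_ext.
- exact: spanned0.
- apply: (spanned_ext E0 ED (a := an_monomial ([::], zero_multi))).
    by move=> A Q X _; rewrite /an_monomial big_nil mpow0 mul1r.
  exact: (spanned_gen _ E0).
- exact: spannedD.
- exact: spannedZ.
- apply: spannedM => // x y /eqP <- /eqP <-; exact: an_monomialM.
Qed.

Lemma an_span_clifford h : an_span 0 (fun A Q X => Q h).
Proof.
apply: (gr_ext an_span_closed (a := fun A Q X => flip_sign R zero_multi h *:
    an_monomial ([::], flip zero_multi h) Q X)).
  by move=> A Q X [cQ _]; rewrite /an_monomial big_nil mulr1 -mpow_flip0.
by apply: (gr_Z an_span_closed); exact: (spanned_gen _ E0).
Qed.

Lemma an_span_perturbation j : an_span 1 (fun A Q X => X j).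
Proof.
apply: (gr_ext an_span_closed (a := an_monomial ([:: (j, zero_multi)], zero_multi))).
  by move=> A Q X _; rewrite /an_monomial big_seq1 !mpow0 mulr1 mul1r.
exact: spanned_gen.
Qed.

End AnSpan.

(** From a list of terms, possibly with repetitions, to a family of coefficients. *)
Lemma collect_coef (V : lmodType R) (M : index -> V) (s : seq (R * index)) r :
  \sum_(i : multi n) \sum_(w : word n r)
    (\sum_(t <- s | t.2 == (val w, i)) t.1) *: M (val w, i) =
  \sum_(t <- s | size t.2.1 == r) t.1 *: M t.2.
Proof.
elim: s => [|t s IH].
  rewrite big_nil big1 // => i _; rewrite big1 // => w _.
  by rewrite big_nil scale0r.
rewrite big_cons -IH.
transitivity (\sum_(i : multi n) \sum_(w : word n r)
    (if t.2 == (val w, i) then t.1 *: M t.2 else 0) +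
  \sum_(i : multi n) \sum_(w : word n r)
    (\sum_(t <- s | t.2 == (val w, i)) t.1) *: M (val w, i)).
  rewrite -big_split; apply: eq_bigr => i _ /=; rewrite -big_split.
  apply: eq_bigr => w _ /=; rewrite big_cons; case: eqP => [->|_].
    by rewrite scalerDl.
  by rewrite add0r.
case: ifP => [sz|nsz]; last first.
  rewrite big1 ?add0r // => i _; rewrite big1 // => w _; case: eqP => // E.
  by rewrite E size_tuple eqxx in nsz.
congr (_ + _); rewrite (bigD1 t.2.2) //= (bigD1 (Tuple sz)) //= -surjective_pairing.
rewrite eqxx big1 => [|w ne]; last first.
  case: eqP => // E; case/negP: ne; apply/eqP/val_inj; by rewrite /= E.
rewrite big1 ?addr0 // => i ne; rewrite big1 // => w _.
by case: eqP => // E; case/negP: ne; rewrite E.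
Qed.

Definition fq_level r (c : multi n -> word n r -> R) : family := fun A Q X =>
  \sum_(i : multi n) \sum_(w : word n r) c i w *: (ratio_word Q X w * mpow Q i).

Definition an_level r (c : multi n -> word n r -> R) : family := fun A Q X =>
  \sum_(i : multi n) \sum_(w : word n r)
    c i w *: (mpow Q i * \prod_(l <- w) (X l.1 * mpow Q l.2)).

Lemma an_span_coef r a : an_span r a ->
  exists c : multi n -> word n r -> R, forall (A : convAlg R) (Q X : 'I_n -> A),
    admissible Q X -> a A Q X = an_level c Q X.
Proof.
move=> [s hs ha]; exists (fun i w => \sum_(t <- s | t.2 == (val w, i)) t.1).
move=> A Q X ad; have /eqP := ha A Q X ad; rewrite subr_eq0 => /eqP ->.
have := collect_coef (fun x => an_monomial x Q X) s r.
rewrite /an_level => ->; rewrite -big_filter.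
by have /all_filterP -> := hs.
Qed.

Lemma filt_csplit (A : convAlg R) i e (Q X : A) : filt i X -> filt i (csplit e Q X).
Proof. by move=> h; apply/filtZ/filtD => //; apply/filtMl/filtMr/filtMl. Qed.

Lemma filt_splits (A : convAlg R) i e (Q : 'I_n -> A) s X :
  filt i X -> filt i (splits e Q s X).
Proof. by elim: s X => //= h s IH X hX; apply: IH; exact: filt_csplit. Qed.

Lemma filt_ratio_prod (A : convAlg R) (Q X : 'I_n -> A) (w : seq (letter n)) :
  (forall j, filt 1 (X j)) -> filt (size w) (\prod_(l <- w) ratio Q X l.2 l.1).
Proof.
move=> hX; elim: w => [|l w IH]; first exact: filtT.
rewrite big_cons /= -add1n; apply: filtM => //.
by apply: (@filt_splits A 1); apply: filtMr.
Qed.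

Lemma filt_fq_level r (c : multi n -> word n r -> R) (A : convAlg R) Q X :
  admissible (A := A) Q X -> filt r (fq_level c Q X).
Proof.
move=> [_ hX]; apply: filt_bigsum => i _; apply: filt_bigsum => w _.
apply/filtZ/filtMr; rewrite -{1}(size_tuple w); exact: filt_ratio_prod.
Qed.

Lemma fq_span_coef i a : fq_span i 0 a ->
  exists c : forall r, multi n -> word n r -> R,
  forall (A : convAlg R) (Q X : 'I_n -> A), admissible Q X ->
    filt i (a A Q X - \sum_(r < i) fq_level (@c r) Q X).
Proof.
move=> [s _ ha].
exists (fun r k w => \sum_(t <- s | t.2 == (val w, k)) t.1) => A Q X ad.
apply: eqm_trans (ha A Q X ad) _.
have E m : \sum_(r < m) fq_level (fun k (w : word n r) =>
      \sum_(t <- s | t.2 == (val w, k)) t.1) Q X =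
    \sum_(t <- s | (size t.2.1 < m)%N) t.1 *: fq_monomial t.2 Q X.
  elim: m => [|m IH]; first by rewrite big_ord0 big_pred0.
  rewrite big_ord_recr /= IH [RHS](bigID (fun t => (size t.2.1 < m)%N)) /=.
  congr (_ + _).
    by apply: eq_bigl => t; rewrite ltnS; case: ltnP => [/ltnW ->|]; rewrite ?andbF.
  apply: etrans (collect_coef (fun x => fq_monomial x Q X) s m) _.
  by apply: eq_bigl => t; rewrite ltnS -leqNgt eqn_leq.
rewrite E /lincomb (bigID (fun t => (size t.2.1 < i)%N)) /= addrAC subrr add0r.
apply: filt_bigsum => t; rewrite -leqNgt => le.
apply/filtZ/filtMr; apply: filt_le le _; apply: filt_ratio_prod; exact: ad.2.
Qed.

End Coefficients.
(** * A free model *)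

(** Matrices that do not lower a given degree of the basis vectors. Filtered by
    the amount by which they raise it, they form a finite-dimensional convenient
    algebra. *)
Section GradedMatrices.
Variables (R : realType) (N : nat) (d : 'I_N.+1 -> nat).

Definition raises (s : nat) (M : 'M[R]_N.+1) : bool :=
  [forall i, forall j, (M i j != 0) ==> (d j + s <= d i)%N].

Lemma raisesP s (M : 'M[R]_N.+1) :
  reflect (forall i j, M i j != 0 -> (d j + s <= d i)%N) (raises s M).
Proof.
apply: (iffP forallP) => [h i j nz|h i]; last by apply/forallP => j; apply/implyP/h.
by have /forallP/(_ j)/implyP/(_ nz) := h i.
Qed.

Lemma raises_lin s (a : R) (u v : 'M[R]_N.+1) :
  raises s u -> raises s v -> raises s (a *: u + v).
Proof.
move=> /raisesP hu /raisesP hv; apply/raisesP => i j; rewrite !mxE.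
have [u0|/hu //] := eqVneq (u i j) 0; have [v0|/hv //] := eqVneq (v i j) 0.
by rewrite u0 v0 mulr0 addr0 eqxx.
Qed.

Lemma raisesM s t (u v : 'M[R]_N.+1) :
  raises s u -> raises t v -> raises (s + t) (u * v).
Proof.
move=> /raisesP hu /raisesP hv; apply/raisesP => i j; apply: contraNleq => lt.
rewrite mxE; apply/eqP/big1 => k _.
have [u0|/hu hik] := eqVneq (u i k) 0; first by rewrite u0 mul0r.
have [v0|/hv hkj] := eqVneq (v k j) 0; first by rewrite v0 mulr0.
by lia.
Qed.

Lemma raises1 : raises 0 1.
Proof.
apply/raisesP => i j; rewrite !mxE; case: (eqVneq i j) => [-> _|_].
  by rewrite addn0.
by rewrite eqxx.
Qed.

Definition graded_pred : {pred 'M[R]_N.+1} := raises 0.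

Lemma graded_subalg : GRing.subalg_closed graded_pred.
Proof.
split=> [|a u v|u v]; first exact: raises1.
  exact: raises_lin.
exact: raisesM.
Qed.

HB.instance Definition _ :=
  GRing.isSubalgClosed.Build R 'M[R]_N.+1 graded_pred
    (GRing.subalg_closed_semi graded_subalg).

Record graded_mx := GradedMx {
  graded_val :> 'M[R]_N.+1;
  _ : graded_val \in graded_pred
}.

HB.instance Definition _ := [isSub for graded_val].
HB.instance Definition _ := [Choice of graded_mx by <:].
HB.instance Definition _ := [SubChoice_isSubAlgebra of graded_mx by <:].

Definition graded_filt (s : nat) : set graded_mx := fun M => raises s (\val M).

Lemma graded_convenient (D : nat) : (forall i, (d i <= D)%N) ->
  convenient (A := graded_mx : algType R) graded_filt.
Proof.
move=> dD.
have raises0 s : raises s 0 by apply/raisesP => i j; rewrite mxE eqxx.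
have high (x : graded_mx) : graded_filt D.+1 x -> x = 0.
  move=> /raisesP h; apply: val_inj; apply/matrixP => i j; rewrite [RHS]mxE.
  apply/eqP; apply: contraT => /h; have := dD i; lia.
split.
- by apply/seteqP; split=> // x _; exact: (valP x).
- move=> s x /raisesP h; apply/raisesP => i j /h; lia.
- move=> s; exact: raises0.
- move=> s a x y hx hy; exact: raises_lin.
- move=> s t x y hx hy; exact: raisesM.
- by move=> x /(_ D.+1)/high.
- move=> u hu; have [N0 hN] := hu D.+1; exists (u N0) => s; exists N0 => m le.
  have /high -> := hN N0 m (leqnn _) le; exact: raises0.
- move=> s.
  pose E (ij : 'I_N.+1 * 'I_N.+1) : graded_mx := insubd 0 (delta_mx ij.1 ij.2).
  exists #|{: 'I_N.+1 * 'I_N.+1}|, (fun l => E (enum_val l)) => x.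
  exists (fun l => \val x (enum_val l).1 (enum_val l).2).
  suff <- : x = \sum_(l < #|{: 'I_N.+1 * 'I_N.+1}|)
     \val x (enum_val l).1 (enum_val l).2 *: E (enum_val l).
    by rewrite subrr; exact: raises0.
  rewrite -(big_enum_val (A := {: 'I_N.+1 * 'I_N.+1})
    (fun ij => \val x ij.1 ij.2 *: E ij)) /=.
  apply: val_inj; rewrite raddf_sum /= [LHS]matrix_sum_delta pair_bigA /=.
  apply: eq_bigr => -[i j] _ /=.
  have [x0|nz] := eqVneq (graded_val x i j) 0; first by rewrite x0 !scale0r.
  rewrite insubdK //; apply/raisesP => k l; rewrite mxE.
  have /raisesP h := valP x.
  by case: andP => [[/eqP -> /eqP ->] _|]; [exact: h|rewrite eqxx].
Qed.

End GradedMatrices.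
Section FlipSigns.
Variables (R : realType) (n : nat).
Implicit Types (i : multi n) (g h : 'I_n).

Lemma flip_signE i h : flip_sign R i h = \prod_(g < n | (g <= h)%N) (-1) ^+ i g.
Proof.
rewrite /flip_sign big_filter big_enum_cond /= [RHS](bigD1 h) //= mulrC; congr (_ * _).
by apply: eq_bigl => g; rewrite ltn_neqAle andbC.
Qed.

Lemma flip_sign_flip i g h :
  flip_sign R (flip i g) h = (-1) ^+ (g <= h)%N * flip_sign R i h.
Proof.
rewrite !flip_signE; case: leqP => gh; last first.
  rewrite mul1r; apply: eq_bigr => l lh; rewrite ffunE; case: eqP => // lg.
  by rewrite -lg ltnNge lh in gh.
rewrite (bigD1 g) //= [in RHS](bigD1 g) //= [RHS]mulrA -(signr_addb R true) ffunE eqxx /=.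
congr (_ * _); apply: eq_bigr => l /andP[_ ne].
by rewrite ffunE (negbTE ne).
Qed.

Lemma flipK i h : flip (flip i h) h = i.
Proof. by apply/ffunP => g; rewrite !ffunE; case: eqP => // _; rewrite negbK. Qed.

Lemma flipC i g h : flip (flip i g) h = flip (flip i h) g.
Proof. by apply/ffunP => l; rewrite !ffunE; case: eqP; case: eqP. Qed.

Lemma flip_sign_sq i h : flip_sign R i h * flip_sign R i h = 1.
Proof.
rewrite flip_signE -big_split big1 //= => g _.
by rewrite -signr_addb addbb.
Qed.

End FlipSigns.

(** A truncated free model: words of length at most [r] in the letters, times
    multipowers, form a basis on which a letter acts by concatenation and a
    Clifford generator by toggling an exponent, up to sign. Applied to the empty
    word, the formal monomials of degree at most [r] give independent vectors. *)
Section FreeModel.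
Variables (R : realType) (n r : nat).

Definition state : Type := ({bseq r of letter n} * multi n)%type.
HB.instance Definition _ := Finite.on state.

Definition vacuum : state := ([bseq], [ffun=> false]).

Lemma card_state : #|{: state}| = #|{: state}|.-1.+1.
Proof. by rewrite prednK //; apply/card_gt0P; exists vacuum. Qed.

Local Notation N := #|{: state}|.-1.

Definition of_index (i : 'I_N.+1) : state := enum_val (cast_ord (esym card_state) i).
Definition to_index (t : state) : 'I_N.+1 := cast_ord card_state (enum_rank t).

Lemma of_indexK : cancel of_index to_index.
Proof. by move=> i; rewrite /to_index /of_index enum_valK cast_ordKV. Qed.

Lemma to_indexK : cancel to_index of_index.
Proof. by move=> t; rewrite /to_index /of_index cast_ordK enum_rankK. Qed.

Definition degree (t : state) : nat := size t.1.
Local Notation deg := (fun i => degree (of_index i)).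

Definition model : convAlg R :=
  @ConvAlg R (graded_mx R deg : algType R) _
    (@graded_convenient R N deg r (fun i => size_bseq (of_index i).1)).

Definition entry (M : model) (t u : state) : R :=
  graded_val (M : graded_mx R deg) (to_index t) (to_index u).

Definition acts (M : model) (u : state) (c : R) (v : state) : Prop :=
  forall t, entry M t u = c * (t == v)%:R.

Lemma model_ext (M M' : model) : (forall t u, entry M t u = entry M' t u) -> M = M'.
Proof.
move=> h; apply: val_inj; apply/matrixP => i j.
by rewrite -(of_indexK i) -(of_indexK j); exact: h.
Qed.

Lemma entryD M M' t u : entry (M + M') t u = entry M t u + entry M' t u.
Proof. by rewrite /entry /= mxE. Qed.

Lemma entryZ a M t u : entry (a *: M) t u = a * entry M t u.
Proof. by rewrite /entry /= mxE. Qed.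

Lemma entryM M M' t u : entry (M * M') t u = \sum_(v : state) entry M t v * entry M' v u.
Proof.
rewrite /entry /= mxE (reindex to_index) //=.
by exists of_index => ? _; [exact: to_indexK|exact: of_indexK].
Qed.

Lemma entry0 t u : entry 0 t u = 0.
Proof. by rewrite /entry /= mxE. Qed.

Lemma entry1 t u : entry 1 t u = (t == u)%:R.
Proof. by rewrite /entry /= mxE (can_eq to_indexK). Qed.

Lemma entry_sum (I : Type) (s : seq I) (P : pred I) (f : I -> model) t u :
  entry (\sum_(l <- s | P l) f l) t u = \sum_(l <- s | P l) entry (f l) t u.
Proof.
by apply: (big_morph (fun M => entry M t u)) => [M M'|]; [exact: entryD|exact: entry0].
Qed.

Lemma actsM M M' u v t c c' : acts M' u c v -> acts M v c' t -> acts (M * M') u (c' * c) t.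
Proof.
move=> h h' s; rewrite entryM (bigD1 v) //= h h' eqxx mulr1 big1 ?addr0; last first.
  by move=> w /negbTE ne; rewrite h ne !mulr0.
by rewrite mulrAC.
Qed.

Lemma acts_eq M M' : (forall u, exists c v, acts M u c v /\ acts M' u c v) -> M = M'.
Proof.
by move=> h; apply: model_ext => t u; have [c [v [-> ->]]] := h u.
Qed.

Lemma actsZ a M u c v : acts M u c v -> acts (a *: M) u (a * c) v.
Proof. by move=> h t; rewrite entryZ h mulrA. Qed.

Lemma acts1 u : acts 1 u 1 u.
Proof. by move=> t; rewrite entry1 mul1r. Qed.

Definition monomial_mx (f : state -> state) (c : state -> R) : model :=
  insubd (0 : graded_mx R deg) (\matrix_(i, j)
    (c (of_index j) * (of_index i == f (of_index j))%:R)).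

Lemma monomial_mx_raises s (f : state -> state) (c : state -> R) :
  (forall u, c u != 0 -> (degree u + s <= degree (f u))%N) ->
  raises deg s (\matrix_(i, j)
    (c (of_index j) * (of_index i == f (of_index j))%:R)).
Proof.
move=> h; apply/raisesP => i j; rewrite mxE.
have [c0|/h le] := eqVneq (c (of_index j)) 0; first by rewrite c0 mul0r eqxx.
by case: (of_index i =P _) => [-> //|_]; rewrite mulr0 eqxx.
Qed.

Lemma monomial_mxP s (f : state -> state) (c : state -> R) :
  (forall u, c u != 0 -> (degree u + s <= degree (f u))%N) ->
  filt (c := model) s (monomial_mx f c) /\
  forall u, acts (monomial_mx f c) u (c u) (f u).
Proof.
move=> h.
have h0 : forall u, c u != 0 -> (degree u + 0 <= degree (f u))%N.
  by move=> u /h; rewrite addn0; apply: leq_trans; exact: leq_addr.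
have E : graded_val (monomial_mx f c) = \matrix_(i, j)
    (c (of_index j) * (of_index i == f (of_index j))%:R).
  by rewrite -[LHS]/(\val _) insubdK //; exact: monomial_mx_raises.
split=> [|u t].
  by rewrite /filt /= /graded_filt /= E; exact: monomial_mx_raises.
by rewrite /entry E mxE !to_indexK.
Qed.

Definition letter_mx (l : letter n) : model :=
  monomial_mx (fun u => (insub_bseq r (l :: u.1), u.2)) (fun u => (size u.1 < r)%:R).

Definition word_sign (h : 'I_n) (w : seq (letter n)) : R :=
  \prod_(l <- w) (-1) ^+ l.2 h.

Definition clifford_mx (h : 'I_n) : model :=
  monomial_mx (fun u => (u.1, flip u.2 h)) (fun u => word_sign h u.1 * flip_sign R u.2 h).

Lemma val_insub_bseq (l : letter n) (u : {bseq r of letter n}) : (size u < r)%N ->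
  val (insub_bseq r (l :: u)) = l :: u.
Proof. by move=> lt; rewrite /insub_bseq insubdK. Qed.

Lemma letter_mxP (l : letter n) : filt 1 (letter_mx l) /\ forall u,
  acts (letter_mx l) u (size u.1 < r)%:R (insub_bseq r (l :: u.1), u.2).
Proof.
apply: (@monomial_mxP 1 (fun u => (insub_bseq r (l :: u.1), u.2))
  (fun u => (size u.1 < r)%:R)) => u /=; rewrite /degree /=.
by case: ltnP => [lt _|]; rewrite ?eqxx // val_insub_bseq //= addn1.
Qed.

Lemma clifford_mxP h u :
  acts (clifford_mx h) u (word_sign h u.1 * flip_sign R u.2 h) (u.1, flip u.2 h).
Proof.
have [|_ ] := @monomial_mxP 0 (fun u => (u.1, flip u.2 h))
  (fun u => word_sign h u.1 * flip_sign R u.2 h); last exact.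
by move=> v _; rewrite addn0.
Qed.

Lemma word_sign_sq h w : word_sign h w * word_sign h w = 1.
Proof.
rewrite /word_sign -big_split big1 //= => g _.
by rewrite -signr_addb addbb.
Qed.

Lemma model_clifford : clifford clifford_mx.
Proof.
apply/cliffordP; split=> [h|g h ne].
  rewrite -scaleN1r; apply: acts_eq => u; exists (-1), u; split.
    have := actsM (clifford_mxP h u) (clifford_mxP h _) => /=.
    rewrite flipK flip_sign_flip leqnn expr1 -surjective_pairing.
    congr (acts _ _ _ _).
    rewrite [LHS](_ : _ = - ((word_sign h u.1 * word_sign h u.1) *
      (flip_sign R u.2 h * flip_sign R u.2 h))); last by ring.
    by rewrite word_sign_sq flip_sign_sq mulr1.
  by have := actsZ (-1) (acts1 u); rewrite mulr1.
rewrite /scomm expr1; apply: acts_eq => u.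
eexists; eexists; split; first exact: actsM (clifford_mxP h u) (clifford_mxP g _).
have := actsZ (-1) (actsM (clifford_mxP g u) (clifford_mxP h _)) => /=.
rewrite flipC; congr (acts _ _ _ _); rewrite !flip_sign_flip.
have : ((g <= h)%N : nat) = ~~ (h <= g)%N :> nat.
  by rewrite -ltnNge ltn_neqAle (inj_eq val_inj) ne.
move=> ->; case: (h <= g)%N => /=; ring.
Qed.

Lemma letter_clifford h (l : letter n) : scomm (l.2 h) (clifford_mx h) (letter_mx l).
Proof.
rewrite /scomm; apply: acts_eq => u.
eexists; eexists; split.
  exact: actsM ((letter_mxP l).2 u) (clifford_mxP h _).
have := actsZ ((-1) ^+ l.2 h) (actsM (clifford_mxP h u) ((letter_mxP l).2 _)) => /=.
congr (acts _ _ _ _); case: ltnP => lt; last by rewrite !(mul0r, mulr0).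
rewrite val_insub_bseq // /word_sign big_cons; ring.
Qed.

Lemma letter_prod_acts (w : seq (letter n)) (k : multi n) (t : {bseq r of letter n}) :
  val t = w -> acts (\prod_(l <- w) letter_mx l) ([bseq], k) 1 (t, k).
Proof.
elim: w t => [|l w IH] t tw.
  have -> : t = [bseq] by apply/eqP; rewrite -val_eqE /= tw.
  by rewrite big_nil; exact: acts1.
have sw : (size w < r)%N by have := size_bseq t; rewrite tw.
pose t' := @Bseq _ _ w (ltnW sw).
have -> : t = insub_bseq r (l :: t').
  by apply/eqP; rewrite -val_eqE tw val_insub_bseq.
have := actsM (IH t' erefl) ((letter_mxP l).2 _).
by rewrite /= sw mulr1 big_cons.
Qed.

Lemma mpow_acts (k : multi n) :
  exists2 c, c != 0 & acts (mpow clifford_mx k) vacuum c ([bseq], k).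
Proof.
suff E (s : seq 'I_n) : uniq s -> exists2 c, c != 0 &
    acts (\prod_(h <- s) clifford_mx h ^+ k h) vacuum c
      ([bseq], [ffun h => (h \in s) && k h]).
  have [c c0 hc] := E (enum 'I_n) (enum_uniq _); exists c => //.
  rewrite mpowE; congr (acts _ _ _ (_, _)): hc.
  by apply/ffunP => h; rewrite ffunE mem_enum.
elim: s => [_|h s IH /= /andP[hs /IH[c c0 hc]]].
  exists 1; first exact: oner_neq0.
  rewrite big_nil (_ : ([bseq], _) = vacuum); first exact: acts1.
  by congr (_, _); apply/ffunP => h; rewrite !ffunE.
rewrite big_cons; case: (boolP (k h)) => kh.
  have := actsM hc (clifford_mxP h _) => /=.
  rewrite /word_sign big_nil mul1r => H.
  eexists; last first.
    congr (acts _ _ _ (_, _)): H.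
    apply/ffunP => g; rewrite !ffunE in_cons.
    by case: eqP => [->|//]; rewrite (negbTE hs) kh.
  rewrite mulf_neq0 //; apply/eqP => z; have := flip_sign_sq R [ffun h => (h \in s) && k h] h.
  by rewrite z mulr0 => /esym/eqP; rewrite oner_eq0.
exists c => //; rewrite expr0 mul1r; congr (acts _ _ _ (_, _)): hc.
apply/ffunP => g; rewrite !ffunE in_cons.
by case: eqP => [->|//]; rewrite (negbTE kh) andbF.
Qed.

Variable P : pred (letter n).

(** With [P] everything, this perturbation is generic; with [P] the Gram-Schmidt
    letters, it is a generic one among those that Gram-Schmidt orthogonalization
    leaves in place. *)
Definition model_pert (j : 'I_n) : model :=
  \sum_(i : multi n | P (j, i)) letter_mx (j, i) * clifford_mx j.

Lemma model_pert_filt j : filt 1 (model_pert j).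
Proof. by apply: filt_bigsum => i _; apply: filtMr; exact: (letter_mxP _).1. Qed.

Lemma model_admissible : admissible clifford_mx model_pert.
Proof. by split; [exact: model_clifford|exact: model_pert_filt]. Qed.

Let sq : forall h, clifford_mx h * clifford_mx h = -1 := clifford_sq model_clifford.

Lemma model_ratio i j : ratio clifford_mx model_pert i j =
  if P (j, i) then letter_mx (j, i) else 0.
Proof.
rewrite -[LHS]/(splits i clifford_mx (enum 'I_n) (model_pert j * ainv (clifford_mx j))).
rewrite ainv_sqN1 // mulr_suml splits_sum.
have E (i' : multi n) : splits i clifford_mx (enum 'I_n)
    (letter_mx (j, i') * clifford_mx j * - clifford_mx j) =
    if i == i' then letter_mx (j, i') else 0.
  rewrite mulr_sqN1K //.
  rewrite (@splits_eigen _ _ _ _ i') // => [|h _]; last exact: letter_clifford.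
  congr (if _ then _ else _); apply/allP/eqP => [h|-> //].
  by apply/ffunP => h'; apply/eqP/h; rewrite mem_enum.
under eq_bigr do rewrite E.
rewrite -big_mkcondr /=; case: ifP => Pi; last first.
  rewrite big1 // => i' /andP[Pi' /eqP ii]; by rewrite ii Pi' in Pi.
rewrite (big_pred1 i) // => i'; rewrite eq_sym; apply/andP/eqP => [[_ /eqP //]|->].
by rewrite Pi eqxx.
Qed.

Lemma model_ratio_word s (w : word n s) : ratio_word clifford_mx model_pert w =
  if all P w then \prod_(l <- w) letter_mx l else 0.
Proof.
rewrite /ratio_word; elim: (tval w) => [|l v IH]; first by rewrite !big_nil.
rewrite !big_cons IH model_ratio -surjective_pairing /=.
by case: (P l); case: (all P v); rewrite ?mul0r ?mulr0.
Qed.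

(** Applied to the empty word, different monomials give nonzero multiples of
    different basis vectors, so that each coefficient can be read off. *)
Lemma model_independent (c : forall s, multi n -> word n s -> R) :
  filt r.+1 (\sum_(s < r.+1) fq_level (@c s) clifford_mx model_pert) ->
  forall s k (w : word n s), (s <= r)%N -> all P w -> c s k w = 0.
Proof.
move=> h s k w sr Pw.
set M := \sum_(_ < _) _ in h.
have szw : (size w <= r)%N by rewrite size_tuple.
pose t : state := (Bseq szw, k).
have M0 : entry M t vacuum = 0.
  move/raisesP: h => h; apply/eqP; apply: contraT => /h.
  rewrite !to_indexK /degree /= size_tuple; lia.
have [b b0 _] := mpow_acts k.
have E s' (k' : multi n) (w' : word n s') : (s' <= r)%N ->
    exists2 b, b != 0 & entry (ratio_word clifford_mx model_pert w' *
      mpow clifford_mx k') t vacuum =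
    b * ((val w' == val w) && (k' == k) && all P w')%:R.
  move=> s'r; have [b' b'0 hb] := mpow_acts k'; exists b' => //.
  rewrite model_ratio_word; case: (all P w'); last first.
    by rewrite mul0r entry0 andbF mulr0.
  have szw' : (size w' <= r)%N by rewrite size_tuple.
  have := actsM hb (letter_prod_acts (t := Bseq szw') k' erefl).
  move=> /(_ t) ->; rewrite mul1r andbT; congr (_ * _%:R).
  by rewrite /t xpair_eqE -val_eqE /= eq_sym [k == _]eq_sym.
move: M0; rewrite /M entry_sum (bigD1 (Ordinal (sr : (s < r.+1)%N))) //=.
rewrite [X in _ + X]big1 ?addr0; last first.
  move=> s' ne; rewrite entry_sum big1 // => k' _; rewrite entry_sum big1 // => w' _.
  rewrite entryZ; have [|b' _ ->] := E s' k' w'; first by rewrite -ltnS.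
  case: eqP => [ww|]; last by rewrite !mulr0.
  case/negP: ne; apply/eqP/val_inj => /=.
  by rewrite -(size_tuple w) -(size_tuple w') -[tval w']/(val w') ww.
rewrite entry_sum (bigD1 k) //= [X in _ + X]big1 ?addr0; last first.
  move=> k' ne; rewrite entry_sum big1 // => w' _.
  rewrite entryZ; have [//|b' _ ->] := E s k' w'.
  by rewrite (negbTE ne) andbF /= !mulr0.
rewrite entry_sum (bigD1 w) //= [X in _ + X]big1 ?addr0; last first.
  move=> w' ne; rewrite entryZ; have [//|b' _ ->] := E s k w'.
  by rewrite val_eqE (negbTE ne) /= !mulr0.
rewrite entryZ; have [//|b' b'0 ->] := E s k w.
by rewrite !eqxx Pw mulr1 => /eqP; rewrite mulf_eq0 (negbTE b'0) orbF => /eqP.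
Qed.

End FreeModel.
(** * Coefficients are determined by sums *)

Section Series.
Variables (R : realType) (n : nat).
Local Notation family := (family R n).
Implicit Types (a : family) (r : nat).

Lemma filt_sum_mulr (A : convAlg R) (u : nat -> A) S (z : A) :
  filt_sum u S -> filt_sum (fun r => u r * z) (S * z).
Proof.
move=> h i; have [N hN] := h i; exists N => m /hN hm.
by rewrite -mulr_suml -mulrBl; exact: filtMr.
Qed.

Lemma fq_levelB r (c c' : multi n -> word n r -> R) (A : convAlg R) (Q X : 'I_n -> A) :
  fq_level c Q X - fq_level c' Q X = fq_level (fun i w => c i w - c' i w) Q X.
Proof.
rewrite /fq_level -sumrB; apply: eq_bigr => i _; rewrite -sumrB.
by apply: eq_bigr => w _; rewrite scalerBl.
Qed.

Lemma fq_truncation_inj r (P : pred (letter n)) (y : model R n r)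
    (c c' : forall s, multi n -> word n s -> R) :
  let Q := @clifford_mx R n r in
  let X := model_pert R r P in
  filt r.+1 (y - \sum_(s < r.+1) fq_level (@c s) Q X) ->
  filt r.+1 (y - \sum_(s < r.+1) fq_level (@c' s) Q X) ->
  forall s k (w : word n s), (s <= r)%N -> all P w -> c s k w = c' s k w.
Proof.
move=> Q X h h' s k w sr Pw; apply/eqP; rewrite -subr_eq0; apply/eqP.
have := @model_independent R n r P (fun s k w => c s k w - c' s k w).
apply=> //.
under eq_bigr do rewrite -fq_levelB.
by rewrite sumrB; apply: eqm_trans h'; exact: filtBC.
Qed.

Lemma fq_series_inj (P : pred (letter n))
    (c c' : forall s, multi n -> word n s -> R) :
  (forall r, exists2 y : model R n r,
    filt_sum (fun s => fq_level (@c s) (@clifford_mx R n r) (model_pert R r P)) y &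
    filt_sum (fun s => fq_level (@c' s) (@clifford_mx R n r) (model_pert R r P)) y) ->
  forall s k (w : word n s), all P w -> c s k w = c' s k w.
Proof.
move=> h s k w Pw; have [y hy hy'] := h s.
have ad := @model_admissible R n s P.
apply: (@fq_truncation_inj s P y c c' _ _ s k w (leqnn s) Pw).
- apply: (filt_sum_remainder _ hy) => r; exact: filt_fq_level.
- apply: (filt_sum_remainder _ hy') => r; exact: filt_fq_level.
Qed.

(** The truncated expansions of a family are compatible, by independence in the
    free model, and so they glue to one series. *)
Lemma fq_series_exists a : (forall i, fq_span i 0 a) ->
  exists c : forall r, multi n -> word n r -> R,
  forall (A : convAlg R) (Q X : 'I_n -> A), admissible Q X ->
    filt_sum (fun r => fq_level (@c r) Q X) (a A Q X).
Proof.
move=> ha; have [C hC] := choice (fun i => fq_span_coef (ha i)).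
exists (fun r => C r.+1 r) => A Q X ad; apply: filt_sumP => i.
suff E r : (r < i)%N -> C i r = C r.+1 r.
  by have := hC i A Q X ad; congr (filt i (_ - _)); apply: eq_bigr => r _; rewrite E.
move=> ri; apply/funext => k; apply/funext => w.
have adm := @model_admissible R n r predT.
apply: (@fq_truncation_inj r predT (a _ (@clifford_mx R n r) (model_pert R r predT))
  (C i) (C r.+1) _ _ r k w (leqnn r)); last by rewrite all_predT.
- have h := filt_le ri (hC i _ _ _ adm); apply: eqm_trans h _.
  apply: (filt_tail (u := fun s => fq_level (C i s) _ _)) ri => s.
  exact: filt_fq_level adm.
- exact: hC.
Qed.

Lemma an_span_fq_level r (c : multi n -> word n r -> R) :
  an_span r (fun A Q X => fq_level c Q X).
Proof.
have hS := an_span_closed R n.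
apply: (gr_sum hS) => i; apply: (gr_sum hS) => w; apply: (gr_Z hS).
have sq (A : convAlg R) (Q X : 'I_n -> A) : admissible Q X ->
    forall h, Q h * Q h = -1 by case=> /clifford_sq.
have h1 := gr_ratio_word hS (@an_span_clifford R n) sq w (@an_span_perturbation R n).
have h2 := gr_mpow hS (@an_span_clifford R n) i.
by have := gr_M hS h1 h2; rewrite muln1 addn0.
Qed.

End Series.

Section Commuting.
Variables (R : realType) (A : convAlg R).

(** The difference [D] of two commuting square roots of -1 satisfies
    [D = D * D * Q / 2]; when small, it lies in every step of the filtration. *)
Lemma sqN1_rigid (P Q : A) : P * P = -1 -> Q * Q = -1 -> Q * P = P * Q ->
  filt 1 (P - Q) -> P = Q.
Proof.
move=> sqP sq QP hD; have [D PE] : exists D, P = Q + D.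
  by exists (P - Q); rewrite addrC subrK.
rewrite {}PE in sqP QP hD *; rewrite addrAC subrr add0r in hD.
have QD : Q * D = D * Q by move: QP; rewrite mulrDr mulrDl => /addrI.
have DE : D = 2^-1 *: (D * D * Q).
  have E : D * Q + D * Q = - (D * D).
    move: sqP; rewrite mulrDl !mulrDr sq QD -!addrA -[RHS]addr0 => /addrI.
    by rewrite addrA => /eqP; rewrite addr_eq0 => /eqP.
  have /(congr1 (fun z => - (z * Q))) := E.
  rewrite mulNr opprK mulrDl -mulrA sq mulrN1 -opprD opprK => <-.
  by rewrite half_double.
suff -> : D = 0 by rewrite addr0.
apply/filt_eq0; elim=> [|i IH]; first exact: filtT.
rewrite DE; apply/filtZ/filtMr; rewrite -add1n; exact: filtM.
Qed.

Lemma is_pol_commuting (H Q : A) : Q * Q = -1 -> filt 1 (H - Q) ->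
  scomm false Q H -> is_pol H Q.
Proof.
move=> sq near; rewrite /scomm scale1r => QH.
have [S [_ hS polS sqS nS]] := is_pol_near sq near.
suff <- : H * S = Q by [].
have QS : Q * S = S * Q.
  apply: (ps_comm hS); rewrite mulrBr mulrBl mulrN mulNr mulrA QH -mulrA QH.
  by rewrite mulrA mulr1 mul1r.
by apply: sqN1_rigid => //; rewrite mulrA QH -mulrA QS mulrA.
Qed.

End Commuting.

(** The letters surviving in the [k]th residue commute with the earlier
    generators; being Gram-Schmidt letters, they then commute with the [k]th
    generator too, which is therefore the polar part of the residue. *)
Lemma model_OGS (R : realType) n r :
  is_OGS (fun j => @clifford_mx R n r j + model_pert R r (@gs_letter n) j)
    (@clifford_mx R n r).
Proof.
set Q := @clifford_mx R n r; set X := model_pert R r _ => k.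
rewrite -[foldl _ _ _]/(splits xpredT Q (below k) (Q k + X k)).
have [sq ac] := (cliffordP Q).1 (@model_clifford R n r).
have acb h : h \in below k -> scomm true (Q h) (Q k).
  by rewrite mem_below => hk; apply: ac; apply: contraTneq hk => ->; rewrite ltnn.
rewrite splitsD (@splits_eigen _ _ _ _ xpredT) // (@eq_all _ _ xpredT) // all_predT.
have -> : splits xpredT Q (below k) (X k) = \sum_(i : multi n | gs_letter (k, i))
    if all (fun h => ~~ i h) (below k) then letter_mx R r (k, i) * Q k else 0.
  rewrite splits_sum; apply: eq_bigr => i _.
  rewrite (@splits_eigen _ _ _ _ (fun h => ~~ i h)) // => h hb.
  by rewrite -addbT; apply: scommM (acb h hb); exact: letter_clifford.
apply: is_pol_commuting => //.
  rewrite addrAC subrr add0r; apply: filt_bigsum => i _.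
  case: ifP => _; last exact: filt0.
  by apply: filtMr; exact: (letter_mxP R r (k, i)).1.
apply: scommD; first exact: scomm_refl.
apply: scomm_sum => i gs; case: ifP => [/allP h0|_]; last first.
  by rewrite /scomm mulr0 mul0r scaler0.
suff ik : i k = false.
  apply: (scommM (b := false) (c := false) _ (scomm_refl _)).
  have := letter_clifford R r k (k, i); by rewrite /= ik.
apply: contraNF gs => ik; rewrite /is_min_supp /= ik; apply/forallP => h.
apply/implyP => ih; rewrite leqNgt; apply/negP => hk.
by have := h0 h; rewrite mem_below hk ih => /(_ isT).
Qed.
(** * The operation of the Gram-Schmidt recipe *)

Definition gs_op (R : realType) (n : nat) (pGS : gs_coef R n) : operation R n :=
  fun A X Y => exists Q : 'I_n -> A, [/\ near_clifford X Q, is_OGS X Q &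
    forall k, filt_sum (gs_term pGS Q (fun j => X j - Q j) k) (Y k)].

Section Recipe.
Variables (R : realType) (n : nat).
Local Notation family := (family R n).
Implicit Types (pGS : gs_coef R n) (p : fq_coef R n).

Lemma exp_termE p (A : convAlg R) (Q X : 'I_n -> A) k r :
  exp_term p Q X k r = fq_level (@p k r) Q X * Q k.
Proof.
rewrite mulr_suml; apply: eq_bigr => i _; rewrite mulr_suml.
by apply: eq_bigr => w _; rewrite scalerAl.
Qed.

Definition gs_extension pGS : fq_coef R n := fun k r i w =>
  if insub w : option (gs_word n r) is Some v then pGS k r i v else 0.

Lemma gs_extension_val pGS k r i (v : gs_word n r) :
  gs_extension pGS k i (val v) = pGS k r i v.
Proof. by rewrite /gs_extension valK. Qed.

Lemma sum_gs_word r (V : nmodType) (F : word n r -> V) :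
  (forall w : word n r, ~~ all (@gs_letter n) w -> F w = 0) ->
  \sum_(w : word n r) F w = \sum_(v : gs_word n r) F (val v).
Proof.
move=> F0; rewrite -(big_sub [pred w : word n r | all (@gs_letter n) w]).
rewrite [RHS]big_mkcond; apply: eq_bigr => w _ /=.
by rewrite inE; case: ifP => // /negbT/F0.
Qed.

Lemma gs_termE pGS (A : convAlg R) (Q X : 'I_n -> A) k r :
  gs_term pGS Q X k r = fq_level (@gs_extension pGS k r) Q X * Q k.
Proof.
rewrite mulr_suml; apply: eq_bigr => i _; rewrite sum_gs_word => [|w nw].
  rewrite mulr_suml; apply: eq_bigr => v _.
  by rewrite gs_extension_val scalerAl.
by rewrite /gs_extension insubN // scale0r.
Qed.

Lemma filt_gs_term pGS (A : convAlg R) (Q X : 'I_n -> A) k r :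
  admissible Q X -> filt r (gs_term pGS Q X k r).
Proof. by move=> ad; rewrite gs_termE; apply/filtMr/filt_fq_level. Qed.

Lemma near_admissible (A : convAlg R) (X Q : 'I_n -> A) :
  near_clifford X Q -> admissible Q (fun j => X j - Q j).
Proof. by case. Qed.

Lemma admissible_near (A : convAlg R) (Q X : 'I_n -> A) :
  admissible Q X -> near_clifford (fun j => Q j + X j) Q.
Proof. by case=> cQ hX; split=> // k; rewrite addrAC subrr add0r. Qed.

Lemma gs_op_total pGS (A : convAlg R) (X Q0 : 'I_n -> A) :
  near_clifford X Q0 -> exists Y, gs_op pGS X Y.
Proof.
move=> nX; have [Q hQ] := is_OGS_exists nX; have [nQ _] := is_OGS_near nX hQ.
have ex k : exists S, filt_sum (gs_term pGS Q (fun j => X j - Q j) k) S.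
  have [|S hS] := @filt_series _ A (gs_term pGS Q (fun j => X j - Q j) k).
    move=> r; exact: filt_gs_term (near_admissible nQ).
  by exists S; exact: filt_sumP.
by have [Y hY] := choice ex; exists Y, Q.
Qed.

Lemma gs_op_fun pGS (A : convAlg R) (X Y Z : 'I_n -> A) :
  gs_op pGS X Y -> gs_op pGS X Z -> Y = Z.
Proof.
move=> [Q [_ hQ hY]] [Q' [_ hQ' hZ]]; rewrite -(is_OGS_uniq hQ hQ') in hZ.
by apply/funext => k; exact: filt_sum_uniq (hY k) (hZ k).
Qed.

Definition ogs (k : 'I_n) : family := fun A Q X =>
  xget (fun=> 0) [set Q' : 'I_n -> A | is_OGS (fun j => Q j + X j) Q'] k.

Lemma ogsP (A : convAlg R) (Q X : 'I_n -> A) : admissible Q X ->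
  is_OGS (fun j => Q j + X j) (fun h => @ogs h A Q X).
Proof.
move=> ad; have [Q' hQ'] := is_OGS_exists (admissible_near ad).
by rewrite /ogs; case: xgetP => [P -> //|/(_ Q')].
Qed.

Lemma ogs_near (A : convAlg R) (Q X : 'I_n -> A) : admissible Q X ->
  near_clifford (fun j => Q j + X j) (fun h => @ogs h A Q X).
Proof. by move=> ad; have [] := is_OGS_near (admissible_near ad) (ogsP ad). Qed.

Lemma fq_span_sum i r (F : nat -> family) : (forall m, fq_span i 0 (F m)) ->
  fq_span i 0 (fun A Q X => \sum_(m < r) F m A Q X).
Proof. by move=> hF; apply: (gr_sum (fq_span_closed R n i)) => l; exact: hF. Qed.

Lemma fq_span_exp i (a : family) m : fq_span i 0 a ->
  fq_span i 0 (fun A Q X => a A Q X ^+ m).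
Proof.
move=> ha; have hS := fq_span_closed R n i; elim: m => [|m IH].
  exact: (gr_ext hS) (gr_1 hS).
by apply: (gr_ext hS) (gr_M hS ha IH) => A Q X _; rewrite exprS.
Qed.

(** Each entry of O^GS is built from the earlier ones by finitely many algebra
    operations, modulo any given step of the filtration. *)
Lemma fq_span_ogs i k : fq_span i 0 (@ogs k).
Proof.
have hS := fq_span_closed R n i.
have [m] := ubnP (k : nat); elim: m k => // m IH k; rewrite ltnS => km.
(* Only the entries below [k] are known to be in the span so far; the others do
   not enter the residue and are replaced by the given generators. *)
pose q (h : 'I_n) : family := if (h < k)%N then @ogs h else fun A Q X => Q h.
have hq h : fq_span i 0 (q h).
  rewrite /q; case: ifP => hk; last exact: fq_span_clifford.
  by apply: IH; exact: leq_trans hk km.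
have sq (A : convAlg R) (Q X : 'I_n -> A) : admissible Q X ->
    forall h, q h A Q X * q h A Q X = -1.
  move=> ad h; rewrite /q; case: ifP => _.
    by have [cQ' _] := ogs_near ad; exact: (clifford_sq cQ').
  by case: ad => /clifford_sq.
pose H : family := fun A Q X =>
  splits xpredT (fun h => q h A Q X) (below k) (Q k + X k).
have hH : fq_span i 0 H.
  apply: (gr_splits hS hq sq).
  exact: (gr_D hS (fq_span_clifford _ _ k) (fq_span_perturbation _ _ k)).
have HE (A : convAlg R) (Q X : 'I_n -> A) : admissible Q X ->
    gs_residue (fun j => Q j + X j) (fun h => @ogs h A Q X) k = H A Q X.
  by move=> ad; apply: eq_splits => h; rewrite mem_below /q => ->.
pose N : family := fun A Q X => - (H A Q X * H A Q X) - 1.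
have hN : fq_span i 0 N.
  exact: (gr_D hS (gr_N hS (gr_M hS hH hH)) (gr_N hS (gr_1 hS))).
have hP : fq_span i 0 (fun A Q X =>
    H A Q X * \sum_(m < i) isqrt_coef R m *: N A Q X ^+ m).
  apply: (gr_M hS hH); apply: (@fq_span_sum i i (fun m A Q X => isqrt_coef R m *: N A Q X ^+ m)) => l.
  by apply: (gr_Z hS); exact: fq_span_exp.
apply: (gr_ext hS (a := fun A Q X =>
  H A Q X * (\sum_(m < i) isqrt_coef R m *: N A Q X ^+ m) +
  (@ogs k A Q X - H A Q X * (\sum_(m < i) isqrt_coef R m *: N A Q X ^+ m)))).
  by move=> A Q X _; rewrite addrC subrK.
apply: (gr_D hS hP); apply: fq_span_filt => A Q X ad.
(* The polar part is a power series in [N], truncated at rank [i] modulo step [i]. *)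
have [S [_ hSer ->]] := is_OGS_series (admissible_near ad) (ogsP ad) k.
rewrite HE // in hSer *; apply: eqmM; [exact: eqm_refl|exact: hSer].
Qed.

Definition gs_value pGS (k : 'I_n) : family := fun A Q X =>
  xget (fun=> 0) [set Y : 'I_n -> A | gs_op pGS (fun j => Q j + X j) Y] k.

Lemma gs_valueP pGS (A : convAlg R) (Q X : 'I_n -> A) : admissible Q X ->
  gs_op pGS (fun j => Q j + X j) (fun k => @gs_value pGS k A Q X).
Proof.
move=> ad; have [Y hY] := gs_op_total pGS (admissible_near ad).
by rewrite /gs_value; case: xgetP => [P -> //|/(_ Y)].
Qed.

Lemma fq_span_gs_value pGS i k : fq_span i 0 (@gs_value pGS k).
Proof.
have hS := fq_span_closed R n i.
have sq (A : convAlg R) (Q X : 'I_n -> A) : admissible Q X ->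
    forall h, @ogs h A Q X * @ogs h A Q X = -1.
  by move=> ad h; have [cQ' _] := ogs_near ad; exact: (clifford_sq cQ').
pose x (j : 'I_n) : family := fun A Q X => Q j + X j - @ogs j A Q X.
have hx j : fq_span i 0 (x j).
  apply: (gr_D hS _ (gr_N hS (fq_span_ogs i j))).
  exact: (gr_D hS (fq_span_clifford _ _ j) (fq_span_perturbation _ _ j)).
pose T r : family := fun A Q X =>
  gs_term pGS (fun h => @ogs h A Q X) (fun j => x j A Q X) k r.
have hT r : fq_span i 0 (T r).
  apply: (gr_sum hS) => kappa; apply: (gr_sum hS) => w; apply: (gr_Z hS).
  apply: (gr_M hS _ (fq_span_ogs i k)); apply: (gr_M hS _).
    exact: (gr_ratio_word (d := 0) hS (fq_span_ogs i) sq _ hx).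
  exact: (gr_mpow hS (fq_span_ogs i)).
apply: (gr_ext hS (a := fun A Q X =>
  \sum_(r < i) T r A Q X + (@gs_value pGS k A Q X - \sum_(r < i) T r A Q X))).
  by move=> A Q X _; rewrite addrC subrK.
apply: (gr_D hS); first exact: (@fq_span_sum i i T).
apply: fq_span_filt => A Q X ad.
have [Q' [nQ' hQ' /(_ k) hY]] := gs_valueP pGS ad.
have QE := is_OGS_uniq hQ' (ogsP ad); subst Q'.
apply: (filt_sum_remainder _ hY) => r.
exact: filt_gs_term (near_admissible nQ').
Qed.

Lemma gs_op_expands pGS : exists2 p : fq_coef R n,
  extends pGS p & expands (gs_op pGS) (exp_term p).
Proof.
have ex k : exists c : forall r, multi n -> word n r -> R,
    forall (A : convAlg R) (Q X : 'I_n -> A), admissible Q X ->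
    filt_sum (fun r => fq_level (@c r) Q X) (@gs_value pGS k A Q X * - Q k).
  apply: (fq_series_exists (a := fun A Q X => @gs_value pGS k A Q X * - Q k)) => i.
  have hS := fq_span_closed R n i.
  exact: (gr_M hS (fq_span_gs_value _ _ _) (gr_N hS (fq_span_clifford _ _ k))).
have [p hp] := choice ex; exists p; last first.
  move=> A Q X cQ hX; have ad : admissible Q X by split.
  exists (fun k => @gs_value pGS k A Q X); first exact: gs_valueP.
  move=> k; have := filt_sum_mulr (Q k) (hp k A Q X ad).
  rewrite mulrN_sqN1K; last exact: clifford_sq.
  by apply: filt_sum_ext => r; rewrite exp_termE.
move=> k r kappa w; rewrite -gs_extension_val.
apply: (@fq_series_inj R n (@gs_letter n) (p k) (@gs_extension pGS k)); last exact: (valP w).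
move=> d; set Q := @clifford_mx R n d; set X := model_pert R d _.
have ad : admissible Q X by exact: model_admissible.
exists (@gs_value pGS k _ Q X * - Q k); first exact: hp.
have [Q' [_ hQ' /(_ k) hY]] := gs_valueP pGS ad.
have QE := is_OGS_uniq hQ' (@model_OGS R n d); subst Q'.
have XE : (fun j => Q j + X j - Q j) = X.
  by apply/funext => j; rewrite addrAC subrr add0r.
rewrite XE in hY; have := filt_sum_mulr (- Q k) hY.
apply: filt_sum_ext => s; rewrite gs_termE -mulrA mulrN clifford_sq ?opprK ?mulr1 //.
exact: ad.1.
Qed.

Lemma expands_an_term pGS p : expands (gs_op pGS) (exp_term p) ->
  exists psi : an_coef R n, expands (gs_op pGS) (an_term psi).
Proof.
move=> hp.
have ex (kr : 'I_n * nat) : exists c : multi n -> word n kr.2 -> R,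
    forall (A : convAlg R) (Q X : 'I_n -> A), admissible Q X ->
    exp_term p Q X kr.1 kr.2 = an_level c Q X.
  case: kr => k r; apply: (an_span_coef (a := fun A Q X => exp_term p Q X k r)).
  have hS := an_span_closed R n.
  apply: (gr_ext hS (a := fun A Q X => fq_level (@p k r) Q X * Q k)).
    by move=> A Q X _; rewrite exp_termE.
  by have := gr_M hS (an_span_fq_level (@p k r)) (an_span_clifford R k); rewrite addn0.
pose psi : an_coef R n := fun k r => projT1 (cid (ex (k, r))).
exists psi => A Q X cQ hX; have [Y hY hs] := hp A Q X cQ hX.
exists Y => // k; apply: filt_sum_ext (hs k) => r.
by rewrite -[RHS]/(an_level (psi k r) Q X) -(projT2 (cid (ex (k, r)))).
Qed.

Lemma gs_op_formal pGS : formalFQ (gs_op pGS).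
Proof.
split.
- exact: gs_op_fun.
- move=> A X; split=> [[Y [Q [nX _ _]]]|[Q nX]]; first by exists Q.
  exact: gs_op_total nX.
- move=> A B phi hphi X Y [Q [nX hQ hY]].
  have sq := clifford_sq nX.1.
  exists (phi \o Q); split; [exact: near_clifford_hom|exact: is_OGS_hom|] => k.
  apply: filt_sum_ext (filt_sum_hom hphi (hY k)) => r.
  rewrite gs_term_hom //; congr (gs_term _ _ _ _ _).
  by apply/funext => j /=; rewrite linearB.
- move=> A B X Y [_ [Q [[cQ nX] _ _]]] [_ [Q' [[cQ' nY] _ _]]].
  apply: (@gs_op_total _ (prodConv A B) _ (fun j => (Q j, Q' j))).
  split=> [i j|k]; last by split; [exact: nX|exact: nY].
  have := cQ i j; have := cQ' i j => E' E; exact: (congr2 pair E E').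
- by have [p _ hp] := gs_op_expands pGS; exact: expands_an_term hp.
Qed.

Lemma exp_term_gs p pGS (A : convAlg R) (Q X : 'I_n -> A) k r : extends pGS p ->
  (forall i j, is_min_supp j i -> ratio Q X i j = 0) ->
  exp_term p Q X k r = gs_term pGS Q X k r.
Proof.
move=> hp h0; apply: eq_bigr => i _; rewrite sum_gs_word => [|w nw].
  by apply: eq_bigr => v _; rewrite hp.
suff -> : ratio_word Q X w = 0 by rewrite !mul0r scaler0.
rewrite /ratio_word; elim: (tval w) nw => //= l v IH; rewrite negb_and big_cons.
case/orP => [/negPn h|/IH ->]; last by rewrite mulr0.
by rewrite h0 ?mul0r.
Qed.

Lemma expands_recipe pGS p (Psi : operation R n) : extends pGS p ->
  formalFQ Psi -> expands Psi (exp_term p) -> gs_recipe Psi (gs_term pGS).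
Proof.
move=> hp fPsi ePsi A X Y hXY.
have [Q0 nX] := (fq_frm fPsi X).1 (ex_intro _ Y hXY).
split; first exact: is_OGS_exists nX.
move=> Q hQ; have [nQ _] := is_OGS_near nX hQ; split=> // k.
have [Y' hY' hs] := ePsi A Q (fun j => X j - Q j) nQ.1 nQ.2.
(* The expansion is available around any Clifford system near [X], in particular
   around [O^GS(X)]. *)
have XE : (fun j => Q j + (X j - Q j)) = X.
  by apply/funext => j; rewrite addrC subrK.
rewrite XE in hY'; rewrite (fq_fun fPsi hXY hY').
apply: filt_sum_ext (hs k) => r; apply: exp_term_gs => // i j.
exact: ratio_OGS nX hQ.
Qed.

(** All operations with the given Gram-Schmidt coefficients follow the same
    recipe, so that their expansions have equal sums; in the free model these
    sums determine the coefficients. *)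
Lemma extension_uniq pGS p p' (Psi Psi' : operation R n) :
  extends pGS p -> formalFQ Psi -> expands Psi (exp_term p) ->
  extends pGS p' -> formalFQ Psi' -> expands Psi' (exp_term p') -> p = p'.
Proof.
move=> hp fPsi ePsi hp' fPsi' ePsi'.
apply/funext => k; apply: functional_extensionality_dep => r.
apply/funext => kappa; apply/funext => w.
apply: (@fq_series_inj R n predT (p k) (p' k)); last by rewrite all_predT.
move=> d; set Q := @clifford_mx R n d; set X := model_pert R d _.
have ad : admissible Q X by exact: model_admissible.
have [Y hY hs] := ePsi _ Q X ad.1 ad.2.
have [Y' hY' hs'] := ePsi' _ Q X ad.1 ad.2.
have YE : Y = Y'.
  have [[Q' hQ'] rec] := expands_recipe hp fPsi ePsi hY.
  have [_ rec'] := expands_recipe hp' fPsi' ePsi' hY'.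
  apply/funext => l; apply: filt_sum_uniq ((rec Q' hQ').2 l) ((rec' Q' hQ').2 l).
have sq := clifford_sq ad.1 k.
have E (c : fq_coef R n) : filt_sum (exp_term c Q X k) (Y k) ->
    filt_sum (fun s => fq_level (@c k s) Q X) (Y k * - Q k).
  move=> /(filt_sum_mulr (- Q k)); apply: filt_sum_ext => s.
  by rewrite exp_termE -mulrA mulrN sq opprK mulr1.
exists (Y k * - Q k); apply: E; first exact: hs.
by rewrite YE.
Qed.

End Recipe.
(** * Operations compatible with sign changes *)

Section OddOperations.
Variables (R : realType) (n : nat).
Local Notation zero_multi := ([ffun=> false] : multi n).
Implicit Types (p : fq_coef R n).

Definition fq_coef_of0 (p0 : fq_coef0 R n) : fq_coef R n := fun k r kappa w =>
  if kappa == zero_multi then p0 k r w else 0.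

Definition gs_coef_of0 (g0 : gs_coef0 R n) : gs_coef R n := fun k r kappa w =>
  if kappa == zero_multi then g0 k r w else 0.

Lemma exp_term_of0 (p0 : fq_coef0 R n) (A : convAlg R) (Q X : 'I_n -> A) k r :
  exp_term (fq_coef_of0 p0) Q X k r = exp_term0 p0 Q X k r.
Proof.
rewrite /exp_term (bigD1 zero_multi) //= [X in _ + X]big1 ?addr0; last first.
  by move=> i /negbTE ne; rewrite big1 // => w _; rewrite /fq_coef_of0 ne scale0r.
rewrite /exp_term0 mulr_suml; apply: eq_bigr => w _.
by rewrite /fq_coef_of0 eqxx mpow0 mulr1 scalerAl.
Qed.

Lemma gs_term_of0 (g0 : gs_coef0 R n) (A : convAlg R) (Q X : 'I_n -> A) k r :
  gs_term (gs_coef_of0 g0) Q X k r = gs_term0 g0 Q X k r.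
Proof.
rewrite /gs_term (bigD1 zero_multi) //= [X in _ + X]big1 ?addr0; last first.
  by move=> i /negbTE ne; rewrite big1 // => w _; rewrite /gs_coef_of0 ne scale0r.
rewrite /gs_term0 mulr_suml; apply: eq_bigr => w _.
by rewrite /gs_coef_of0 eqxx mpow0 mulr1 scalerAl.
Qed.

Lemma extends_of0 (g0 : gs_coef0 R n) (p0 : fq_coef0 R n) : extends0 g0 p0 -> extends (gs_coef_of0 g0) (fq_coef_of0 p0).
Proof. by move=> h k r kappa w; rewrite /fq_coef_of0 h. Qed.

Lemma expands_of0 (Psi : operation R n) (p0 : fq_coef0 R n) :
  expands Psi (exp_term0 p0) -> expands Psi (exp_term (fq_coef_of0 p0)).
Proof.
move=> h A Q X cQ hX; have [Y hY hs] := h A Q X cQ hX; exists Y => // k.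
by apply: filt_sum_ext (hs k) => r; rewrite exp_term_of0.
Qed.

Lemma sign_mulr (A : convAlg R) (b : bool) (x : A) : (-1) ^+ b * x = (-1) ^+ b *: x.
Proof. by case: b; rewrite ?expr0 ?expr1 ?mul1r ?scale1r ?mulN1r ?scaleN1r. Qed.

Lemma ratio_word_sign (d : 'I_n -> bool) (A : convAlg R) (Q X : 'I_n -> A) r
    (w : word n r) : (forall h, Q h * Q h = -1) ->
  ratio_word (fun h => (-1) ^+ d h *: Q h) (fun h => (-1) ^+ d h *: X h) w =
  ratio_word Q X w.
Proof. by move=> sq; apply: eq_bigr => l _; exact: ratio_sign. Qed.

Lemma fq_level_sign r (c : multi n -> word n r -> R) (d : 'I_n -> bool)
    (A : convAlg R) (Q X : 'I_n -> A) : (forall h, Q h * Q h = -1) ->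
  fq_level c (fun h => (-1) ^+ d h *: Q h) (fun h => (-1) ^+ d h *: X h) =
  fq_level (fun i w => (\prod_(g < n) (-1) ^+ (d g && i g)) * c i w) Q X.
Proof.
move=> sq; apply: eq_bigr => i _; apply: eq_bigr => w _.
by rewrite ratio_word_sign // mpow_sign -scalerAr scalerA mulrC.
Qed.

Lemma filt_sumZ (A : convAlg R) (a : R) (u : nat -> A) S :
  filt_sum u S -> filt_sum (fun r => a *: u r) (a *: S).
Proof.
move=> h i; have [N hN] := h i; exists N => m /hN hm.
by rewrite -scaler_sumr; exact: eqmZ.
Qed.

(** Gram-Schmidt orthogonalization commutes with sign changes and the ratios are
    invariant, so without multipowers the recipe is odd in each variable. *)
Lemma gs_op_vL (g0 : gs_coef0 R n) : vL (gs_op (gs_coef_of0 g0)).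
Proof.
move=> A X Y [Q [nX hQ hY]] i; have sq := clifford_sq nX.1.
have signE (Z : 'I_n -> A) :
    (fun j => (-1) ^+ i j * Z j) = (fun j => (-1) ^+ i j *: Z j).
  by apply/funext => j; exact: sign_mulr.
rewrite !signE; exists (fun j => (-1) ^+ i j *: Q j); split.
- exact: near_clifford_sign.
- exact: is_OGS_sign.
- move=> k; apply: filt_sum_ext (filt_sumZ ((-1) ^+ i k) (hY k)) => r.
  rewrite !gs_term_of0 /gs_term0 -scalerAr; congr (_ *: (_ * _)).
  apply: eq_bigr => w _; rewrite -(ratio_word_sign i _ _ sq).
  congr (_ *: ratio_word _ _ _); apply/funext => j.
  by rewrite scalerBr.
Qed.

(** Evaluating at a system with one sign changed multiplies by -1 the terms whose
    multipower contains that generator, while the sum is only multiplied by the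
    sign of the [k]th entry; by independence these coefficients vanish. *)
Lemma vL_multipower p (Psi : operation R n) : formalFQ Psi -> vL Psi ->
  expands Psi (exp_term p) ->
  forall k r kappa w, kappa != zero_multi -> p k r kappa w = 0.
Proof.
move=> fPsi vPsi ePsi k r kappa w nz.
have [h kh] : exists h, kappa h.
  apply/existsP; apply: contraNT nz => /existsPn h0.
  by apply/eqP/ffunP => h; rewrite ffunE; exact/negbTE/h0.
(* The sign change of the single generator [h], and the sign [s i] by which it
   multiplies the multipower of exponent [i]. *)
pose d : multi n := [ffun g => g == h].
pose s (i : multi n) : R := \prod_(g < n) (-1) ^+ (d g && i g).
suff E : p k r kappa w = s kappa * p k r kappa w.
  have sE : s kappa = -1.
    rewrite /s (bigD1 h) //= ffunE eqxx kh expr1 big1 ?mulr1 // => g gh.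
    by rewrite ffunE (negbTE gh).
  move: E; rewrite sE mulN1r => /eqP; rewrite -subr_eq0 opprK -mulr2n.
  by rewrite mulrn_eq0 => /eqP.
apply: (@fq_series_inj R n predT (p k) (fun r i w => s i * p k r i w)); last first.
  by rewrite all_predT.
move=> m; set Q := @clifford_mx R n m; set X := model_pert R m _.
have ad : admissible Q X by exact: model_admissible.
have [Y hY hs] := ePsi _ Q X ad.1 ad.2.
have sq := clifford_sq ad.1.
pose Q' j := (-1) ^+ d j *: Q j; pose X' j := (-1) ^+ d j *: X j.
have [Y' hY' hs'] := ePsi _ Q' X' (clifford_sign d ad.1) (fun j => filtZ _ (ad.2 j)).
have YE : Y' = fun j => (-1) ^+ d j *: Y j.
  have := vPsi _ _ _ hY d.
  rewrite (_ : (fun j => _ * (Q j + X j)) = fun j => Q' j + X' j); last first.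
    by apply/funext => j; rewrite sign_mulr scalerDr.
  rewrite (_ : (fun j => _ * Y j) = fun j => (-1) ^+ d j *: Y j); last first.
    by apply/funext => j; rewrite sign_mulr.
  exact: (fq_fun fPsi).
have sqk : Q k * - Q k = 1 by rewrite mulrN sq opprK.
exists (Y k * - Q k).
  move: (filt_sum_mulr (- Q k) (hs k)); apply: filt_sum_ext => t.
  by rewrite exp_termE -mulrA sqk mulr1.
have := filt_sum_mulr (- Q k) (filt_sumZ ((-1) ^+ d k) (hs' k)).
rewrite YE scalerA -signr_addb addbb scale1r; apply: filt_sum_ext => t.
rewrite exp_termE -scalerAr scalerA -signr_addb addbb scale1r -mulrA sqk mulr1.
exact: (fq_level_sign (@p k t) d X sq).
Qed.

Lemma gs_op_expands0 (g0 : gs_coef0 R n) : exists2 p0 : fq_coef0 R n,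
  extends0 g0 p0 & expands (gs_op (gs_coef_of0 g0)) (exp_term0 p0).
Proof.
have [p hp ep] := gs_op_expands (gs_coef_of0 g0).
have vanish := vL_multipower (gs_op_formal _) (@gs_op_vL g0) ep.
exists (fun k r w => p k r zero_multi w).
  by move=> k r w; rewrite hp /gs_coef_of0 eqxx.
move=> A Q X cQ hX; have [Y hY hs] := ep A Q X cQ hX; exists Y => // k.
apply: filt_sum_ext (hs k) => r; rewrite -exp_term_of0.
apply: eq_bigr => i _; apply: eq_bigr => w _; rewrite /fq_coef_of0.
by case: eqVneq => [->//|ne]; rewrite vanish.
Qed.

Lemma fq_coef_of0_inj (p0 p0' : fq_coef0 R n) : fq_coef_of0 p0 = fq_coef_of0 p0' -> p0 = p0'.
Proof.
move=> E; apply/funext => k; apply: functional_extensionality_dep => r.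
apply/funext => w; have := congr1 (fun p : fq_coef R n => p k r zero_multi w) E.
by rewrite /fq_coef_of0 eqxx.
Qed.

End OddOperations.

(** * Counting the free coefficients *)

Section Counting.

Lemma card_all_tuple (T : finType) (P : pred T) r :
  #|{: {w : r.-tuple T | all P w}}| = (#|P| ^ r)%N.
Proof.
pose f (t : r.-tuple {x : T | P x}) : r.-tuple T := map_tuple val t.
have f_inj : injective f.
  move=> t u /(congr1 val) /= E; apply: val_inj; exact: (inj_map val_inj) E.
rewrite card_sig -[RHS](_ : #|codom f| = _); last first.
  by rewrite card_codom // card_tuple card_sig; congr (_ ^ _)%N; apply: eq_card.
apply: eq_card => w; rewrite inE; apply/idP/codomP => [Pw|[t ->]]; last first.
  by apply/allP => _ /mapP[x _ ->]; exact: (valP x).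
have [s sw] : exists s : seq {x : T | P x}, map val s = w.
  elim: (tval w) Pw => [|x v IH] /=; first by exists [::].
  by case/andP=> Px /IH[s <-]; exists (exist _ x Px :: s).
have szs : size s == r by rewrite -(size_map val) sw size_tuple.
by exists (Tuple szs); apply: val_inj; rewrite /= sw.
Qed.

(** Every nonzero multi-index excludes exactly one letter. *)
Lemma card_min_supp n :
  #|[pred l : letter n | is_min_supp l.1 l.2]| = (2 ^ n - 1)%N.
Proof.
have card_multi : #|{: multi n}| = (2 ^ n)%N.
  by rewrite card_ffun card_bool card_ord.
rewrite subn1 -card_multi -(cardC1 ([ffun=> false] : multi n)).
have inj : {in [pred l : letter n | is_min_supp l.1 l.2] &, injective snd}.
  move=> [j i] [j' i'] /= /andP[/= ij /forallP mj] /andP[/= ij' /forallP mj'] ii.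
  rewrite {}ii in ij mj *; congr (_, _); apply/val_inj/anti_leq.
  by rewrite (implyP (mj j')) // (implyP (mj' j)).
rewrite -(card_in_image inj); apply: eq_card => i; rewrite [RHS]inE. apply/idP/idP => [/fintype.imageP[[j i'] mj ->]|nz].
  by case/andP: mj => /= ij _; apply: contraTneq ij => ->; rewrite ffunE.
have [h ih] : exists h, i h.
  apply/existsP; apply: contraNT nz => /existsPn h0.
  by apply/eqP/ffunP => h; rewrite ffunE; exact/negbTE/h0.
case: (arg_minnP (fun j : 'I_n => j : nat) ih) => j ij minj.
apply/fintype.imageP; exists (j, i) => //; rewrite inE /is_min_supp /= ij; apply/forallP => g.
by apply/implyP; exact: minj.
Qed.

Lemma card_gs_letter n : (0 < n)%N ->
  #|@gs_letter n| = ((n - 1) * 2 ^ n + 1)%N.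
Proof.
move=> n0; have card_letter : #|{: letter n}| = (n * 2 ^ n)%N.
  by rewrite card_prod card_ord card_ffun card_bool card_ord.
have := cardC [pred l : letter n | is_min_supp l.1 l.2].
rewrite card_min_supp card_letter (_ : #|[predC _]| = #|@gs_letter n|); last first.
  exact: eq_card.
have : (0 < 2 ^ n)%N by rewrite expn_gt0.
rewrite mulnBl mul1n; have : (2 ^ n <= n * 2 ^ n)%N by rewrite leq_pmull.
lia.
Qed.

Lemma card_gs_word n r : (0 < n)%N ->
  #|{: gs_word n r}| = (((n - 1) * 2 ^ n + 1) ^ r)%N.
Proof. by move=> n0; rewrite -card_gs_letter // -card_all_tuple. Qed.

End Counting.

(** * The theorem *)

Theorem theorem4p7 (R : realType) (n : nat) (n_gt0 : (0 < n)%N) :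
  (forall pGS : gs_coef R n,
     (exists! p : fq_coef R n, extends pGS p /\
        exists Psi : operation R n, formalFQ Psi /\ expands Psi (exp_term p)) /\
     (forall (p : fq_coef R n) (Psi : operation R n), extends pGS p ->
        formalFQ Psi -> expands Psi (exp_term p) ->
        gs_recipe Psi (gs_term pGS))) /\
  (forall pGS : gs_coef0 R n,
     (exists! p : fq_coef0 R n, extends0 pGS p /\
        exists Psi : operation R n,
          [/\ formalFQ Psi, vL Psi & expands Psi (exp_term0 p)]) /\
     (forall (p : fq_coef0 R n) (Psi : operation R n), extends0 pGS p ->
        formalFQ Psi -> vL Psi -> expands Psi (exp_term0 p) ->
        gs_recipe Psi (gs_term0 pGS))) /\
  (forall r : nat,
     #|{: 'I_n * multi n * gs_word n r}| =
       (((n - 1) * 2 ^ n + 1) ^ r * 2 ^ n * n)%N /\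
     #|{: 'I_n * gs_word n r}| = (((n - 1) * 2 ^ n + 1) ^ r * n)%N).
Proof.
split; last split.
- move=> pGS; split; last by move=> p Psi; exact: expands_recipe.
  have [p hp ep] := gs_op_expands pGS; have fop := gs_op_formal pGS.
  exists p; split; first by split=> //; exists (gs_op pGS).
  move=> p' [hp' [Psi' [fPsi' ePsi']]].
  exact: extension_uniq hp fop ep hp' fPsi' ePsi'.
- move=> g0; split; last first.
    move=> p Psi hp fPsi vPsi ePsi A X Y hXY.
    have [ex rec] := expands_recipe (extends_of0 hp) fPsi (expands_of0 ePsi) hXY.
    split=> // Q hQ; have [nQ hs] := rec Q hQ; split=> // k.
    by apply: filt_sum_ext (hs k) => r; exact: gs_term_of0.
  have [p0 hp ep] := gs_op_expands0 g0; have fop := gs_op_formal (gs_coef_of0 g0).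
  exists p0; split.
    by split=> //; exists (gs_op (gs_coef_of0 g0)); split=> //; exact: gs_op_vL.
  move=> p0' [hp' [Psi' [fPsi' _ ePsi']]]; apply: fq_coef_of0_inj.
  exact: extension_uniq (extends_of0 hp) fop (expands_of0 ep)
    (extends_of0 hp') fPsi' (expands_of0 ePsi').
- move=> r; rewrite !card_prod card_gs_word // card_ord card_ffun card_bool card_ord.
  by split; [rewrite mulnC (mulnC n (2 ^ n)%N) mulnA|rewrite mulnC].
Qed.
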